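(* Let $G$ be a Lie group with Lie algebra $\mathfrak{g}$, and let $G$ act non-trivially by quaternionic automorphisms on a connected integrable quaternionic manifold $M$ of dimension $4n$. Then there is a non-trivial representation $\rho:\mathfrak{g}\to\mathfrak{sl}_{n+1}(\mathbb{H})$.
   Context: $\mathbb{H}$ denotes the quaternions. Fix an $\mathbb{R}$-linear identification $\mathbb{H}^n\cong\mathbb{R}^{4n}$ of the right quaternionic vector space $\mathbb{H}^n$; $\mathrm{GL}(n,\mathbb{H})\cdot\mathbb{H}^*\subset \mathrm{GL}(4n,\mathbb{R})$ is the group of maps $v\mapsto Avq$ with $A\in\mathrm{GL}(n,\mathbb{H})$, $q\in\mathbb{H}^*$. An almost quaternionic structure on a smooth manifold $M^{4n}$ is a principal $\mathrm{GL}(n,\mathbb{H})\cdot\mathbb{H}^*$-subbundle $\mathcal{B}(M)$ of the frame bundle of $M$. It is integrable if around every point there is a coordinate chart $(x_1,\dots,x_{4n})$ such that $(\partial/\partial x_1,\dots,\partial/\partial x_{4n})$ is a section of $\mathcal{B}(M)$. An integrable quaternionic manifold is a smooth manifold with an integrable almost quaternionic structure. A quaternionic automorphism of $M$ is a diffeomorphism of $M$ whose induced map on the frame bundle preserves $\mathcal{B}(M)$. $\mathfrak{sl}_{n+1}(\mathbb{H})$ is the Lie algebra of $\mathrm{SL}_{n+1}(\mathbb{H})$, i.e. the real Lie algebra of $(n+1)\times(n+1)$ quaternionic matrices whose trace has zero real part. A representation $\rho:\mathfrak{g}\to\mathfrak{sl}_{n+1}(\mathbb{H})$ is an $\mathbb{R}$-linear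 Lie algebra homomorphism; it is non-trivial if it is not zero.
   Formalization: ''G acts non-trivially'' is read as: the identity component of G acts non-trivially (automatic for connected G). Otherwise the claim fails, e.g. for the discrete group Z acting on H^n by translations, where the Lie algebra is 0. *)

(* Defs.v *)
From HB Require Import structures.
From mathcomp Require Import all_boot all_order all_algebra.
From mathcomp Require Import ring.
From mathcomp Require Import all_classical all_reals all_analysis.
Import Order.TTheory GRing.Theory Num.Theory numFieldNormedType.Exports.

Set Implicit Arguments.
Unset Strict Implicit.
Unset Printing Implicit Defensive.

Local Open Scope classical_set_scope.
Local Open Scope ring_scope.

(** * Quaternions *)

Record quaternion (R : Type) : Type :=
  Quaternion { qre : R; qi : R; qj : R; qk : R }.

Section QuaternionRing.
Variable R : comNzRingType.
Local Notation H := (quaternion R).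

Definition tuple_of_quaternion (x : H) := (qre x, qi x, qj x, qk x).
Definition quaternion_of_tuple (t : R * R * R * R) : H :=
  let: (a, b, c, d) := t in Quaternion a b c d.
Lemma tuple_of_quaternionK : cancel tuple_of_quaternion quaternion_of_tuple.
Proof. by case. Qed.

HB.instance Definition _ := Choice.copy H (can_type tuple_of_quaternionK).

Definition quaternion_add (x y : H) : H :=
  Quaternion (qre x + qre y) (qi x + qi y) (qj x + qj y) (qk x + qk y).
Definition quaternion_opp (x : H) : H :=
  Quaternion (- qre x) (- qi x) (- qj x) (- qk x).
Definition quaternion_mul (x y : H) : H :=
  Quaternion
    (qre x * qre y - qi x * qi y - qj x * qj y - qk x * qk y)
    (qre x * qi y + qi x * qre y + qj x * qk y - qk x * qj y)
    (qre x * qj y - qi x * qk y + qj x * qre y + qk x * qi y)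
    (qre x * qk y + qi x * qj y - qj x * qi y + qk x * qre y).
Definition quaternion_of_real (a : R) : H := Quaternion a 0 0 0.

Lemma quaternion_addA : associative quaternion_add.
Proof. by case=> ? ? ? ? [? ? ? ?] [? ? ? ?]; congr Quaternion; apply: addrA. Qed.
Lemma quaternion_addC : commutative quaternion_add.
Proof. by case=> ? ? ? ? [? ? ? ?]; congr Quaternion; apply: addrC. Qed.
Lemma quaternion_add0 : left_id (quaternion_of_real 0) quaternion_add.
Proof. by case=> ? ? ? ?; congr Quaternion; apply: add0r. Qed.
Lemma quaternion_addN :
  left_inverse (quaternion_of_real 0) quaternion_opp quaternion_add.
Proof. by case=> ? ? ? ?; congr Quaternion; apply: addNr. Qed.

HB.instance Definition _ := GRing.isZmodule.Build H
  quaternion_addA quaternion_addC quaternion_add0 quaternion_addN.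

Lemma quaternion_mulA : associative quaternion_mul.
Proof. by case=> ? ? ? ? [? ? ? ?] [? ? ? ?]; congr Quaternion => /=; ring. Qed.
Lemma quaternion_mul1l : left_id (quaternion_of_real 1) quaternion_mul.
Proof. by case=> ? ? ? ?; congr Quaternion => /=; ring. Qed.
Lemma quaternion_mul1r : right_id (quaternion_of_real 1) quaternion_mul.
Proof. by case=> ? ? ? ?; congr Quaternion => /=; ring. Qed.
Lemma quaternion_mulDl : left_distributive quaternion_mul +%R.
Proof. by case=> ? ? ? ? [? ? ? ?] [? ? ? ?]; congr Quaternion => /=; ring. Qed.
Lemma quaternion_mulDr : right_distributive quaternion_mul +%R.
Proof. by case=> ? ? ? ? [? ? ? ?] [? ? ? ?]; congr Quaternion => /=; ring. Qed.
Lemma quaternion_1_neq0 : quaternion_of_real 1 != 0.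
Proof. by apply/eqP => -[/eqP]; rewrite oner_eq0. Qed.

HB.instance Definition _ := GRing.Zmodule_isNzRing.Build H
  quaternion_mulA quaternion_mul1l quaternion_mul1r
  quaternion_mulDl quaternion_mulDr quaternion_1_neq0.

End QuaternionRing.

(** * Smooth manifolds *)

(* For [U] open, [Cr_on r U f] says that [f] is of class C^r on [U]. *)
Fixpoint Cr_on (R : realType) (m : nat) (V : normedModType R) (r : nat)
    (U : set 'rV[R]_m) (f : 'rV[R]_m -> V) : Prop :=
  if r is r'.+1 then
    (forall x, U x -> differentiable f x) /\
    (forall v : 'rV[R]_m, Cr_on r' U ('D_v f))
  else forall x, U x -> {for x, continuous f}.

Definition smooth_on (R : realType) (m : nat) (V : normedModType R)
    (U : set 'rV[R]_m) (f : 'rV[R]_m -> V) : Prop :=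
  forall r, Cr_on r U f.

(* A homeomorphism from the open set [dom] onto the open set [cod]; [coords] and
   [param] are arbitrary outside [dom] and [cod]. *)
Record chart (R : realType) (m : nat) (M : topologicalType) : Type := Chart {
  dom : set M;
  cod : set 'rV[R]_m;
  coords : M -> 'rV[R]_m;
  param : 'rV[R]_m -> M;
  dom_open : open dom;
  cod_open : open cod;
  coord_cod : forall x, dom x -> cod (coords x);
  param_dom : forall y, cod y -> dom (param y);
  coordK : forall x, dom x -> param (coords x) = x;
  paramK : forall y, cod y -> coords (param y) = y;
  coord_continuous : forall x, dom x -> {for x, continuous coords};
  param_continuous : forall y, cod y -> {for y, continuous param} }.

Definition local_map (R : realType) (m1 m2 : nat) (M N : topologicalType)
    (f : M -> N) (c : chart R m1 M) (c' : chart R m2 N) :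
    'rV[R]_m1 -> 'rV[R]_m2 :=
  fun y => coords c' (f (param c y)).

Definition smooth_in_charts (R : realType) (m1 m2 : nat)
    (M N : topologicalType) (f : M -> N)
    (c : chart R m1 M) (c' : chart R m2 N) : Prop :=
  smooth_on [set y | cod c y /\ dom c' (f (param c y))] (local_map f c c').

Definition compatible (R : realType) (m : nat) (M : topologicalType)
    (c c' : chart R m M) : Prop :=
  smooth_in_charts id c c' /\ smooth_in_charts id c' c.

Record manifold (R : realType) (m : nat) (M : topologicalType) : Type :=
  Manifold {
    atlas : set (chart R m M);
    manifold_hausdorff : hausdorff_space M;
    manifold_second_countable : @second_countable M;
    atlas_cover : forall x, exists2 c, atlas c & dom c x;
    atlas_compatible : forall c c', atlas c -> atlas c' -> compatible c c';
    atlas_maximal : forall c,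
      (forall c', atlas c' -> compatible c c') -> atlas c }.

Definition chart_at (R : realType) (m : nat) (M : topologicalType)
    (S : manifold R m M) (x : M) : set (chart R m M) :=
  [set c | atlas S c /\ dom c x].

Definition smooth_map (R : realType) (m1 m2 : nat) (M N : topologicalType)
    (SM : manifold R m1 M) (SN : manifold R m2 N) (f : M -> N) : Prop :=
  continuous f /\
  forall c c', atlas SM c -> atlas SN c' -> smooth_in_charts f c c'.

(* Smoothness of [f] on the product manifold, tested in the product charts. *)
Definition smooth_map2 (R : realType) (m1 m2 m : nat)
    (M1 M2 N : topologicalType)
    (S1 : manifold R m1 M1) (S2 : manifold R m2 M2) (SN : manifold R m N)
    (f : M1 -> M2 -> N) : Prop :=
  continuous (fun z : M1 * M2 => f z.1 z.2) /\
  forall c1 c2 c, atlas S1 c1 -> atlas S2 c2 -> atlas SN c ->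
    let F (y : 'rV[R]_(m1 + m2)) :=
      f (param c1 (lsubmx y)) (param c2 (rsubmx y)) in
    smooth_on
      [set y | [/\ cod c1 (lsubmx y), cod c2 (rsubmx y) & dom c (F y)]]
      (fun y => coords c (F y)).

(** * Tangent vectors and frames *)

(* An [r]-tuple of tangent vectors at [x] is the family of its component
   matrices in the charts around [x], one vector per row, related by the
   Jacobians of the changes of coordinates ([v *m 'J f y] is the differential
   of [f] at [y] applied to the row [v]). Components in the other charts are
   set to 0, so that equality of families is equality of tangent vectors. *)
Definition is_tangent (R : realType) (m : nat) (M : topologicalType)
    (S : manifold R m M) (r : nat) (x : M)
    (v : chart R m M -> 'M[R]_(r, m)) : Prop :=
  (forall c c', chart_at S x c -> chart_at S x c' ->
     v c' = v c *m 'J (local_map id c c') (coords c x)) /\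
  (forall c, ~ chart_at S x c -> v c = 0).

Definition is_frame (R : realType) (m : nat) (M : topologicalType)
    (S : manifold R m M) (x : M) (F : chart R m M -> 'M[R]_m) : Prop :=
  is_tangent S x F /\ forall c, chart_at S x c -> F c \in unitmx.

(* [w], at [f x], is the image of [v], at [x], under the differential of [f]. *)
Definition differential_maps (R : realType) (m1 m2 : nat)
    (M N : topologicalType) (SM : manifold R m1 M) (SN : manifold R m2 N)
    (f : M -> N) (x : M) (r : nat)
    (v : chart R m1 M -> 'M[R]_(r, m1)) (w : chart R m2 N -> 'M[R]_(r, m2)) :
    Prop :=
  forall c c', chart_at SM x c -> chart_at SN (f x) c' ->
    w c' = v c *m 'J (local_map f c c') (coords c x).

Definition smooth_tangent_field (R : realType) (m : nat) (M : topologicalType)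
    (S : manifold R m M) (r : nat) (U : set M)
    (X : M -> chart R m M -> 'M[R]_(r, m)) : Prop :=
  forall c, atlas S c ->
    smooth_on [set y | cod c y /\ U (param c y)] (fun y => X (param c y) c).

(** * Lie groups and their Lie algebras *)

(* A group with a topology, a priori unrelated; [lie_group] relates them. *)
#[short(type="topGroupType")]
HB.structure Definition TopGroup := {G of Topological G & Group G}.

(* Continuity of the operations is part of [smooth_map2] and [smooth_map]. *)
Record lie_group (R : realType) (k : nat) (G : topGroupType) : Type :=
  LieGroup {
    lie_manifold :> manifold R k G;
    lie_mul_smooth :
      smooth_map2 lie_manifold lie_manifold lie_manifold
        (fun g h : G => (g * h)%g);
    lie_inv_smooth :
      smooth_map lie_manifold lie_manifold (fun g : G => (g^-1)%g) }.

Definition left_invariant (R : realType) (k : nat) (G : topGroupType)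
    (L : lie_group R k G) (X : G -> chart R k G -> 'rV[R]_k) : Prop :=
  [/\ forall g, is_tangent L g (X g),
      smooth_tangent_field L setT X &
      forall g h : G,
        differential_maps L L (fun x : G => (g * x)%g) h (X h) (X (g * h)%g)].

(* In coordinates, [X, Y]^i = X^j d_j Y^i - Y^j d_j X^i. *)
Definition lie_bracket (R : realType) (m : nat) (M : topologicalType)
    (X Y : M -> chart R m M -> 'rV[R]_m) : M -> chart R m M -> 'rV[R]_m :=
  fun x c =>
    'D_(X x c) (fun y => Y (param c y) c) (coords c x)
    - 'D_(Y x c) (fun y => X (param c y) c) (coords c x).

Definition in_sl (R : realType) (m : nat) (A : 'M[quaternion R]_m) : Prop :=
  qre (\tr A) = 0.

(* The Lie algebra of [L] is the space of left-invariant vector fields; the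
   values of [rho] on other families are irrelevant. *)
Definition is_sl_representation (R : realType) (k : nat) (G : topGroupType)
    (L : lie_group R k G) (m : nat)
    (rho : (G -> chart R k G -> 'rV[R]_k) -> 'M[quaternion R]_m) : Prop :=
  [/\ forall X, left_invariant L X -> in_sl (rho X),
      forall a X Y, left_invariant L X -> left_invariant L Y ->
        rho (a *: X + Y) = quaternion_of_real a *: rho X + rho Y &
      forall X Y, left_invariant L X -> left_invariant L Y ->
        rho (lie_bracket X Y) = rho X *m rho Y - rho Y *m rho X].

Definition smooth_action (R : realType) (k m : nat) (G : topGroupType)
    (L : lie_group R k G) (M : topologicalType) (S : manifold R m M)
    (act : G -> M -> M) : Prop :=
  [/\ forall x, act 1%g x = x,
      forall g h x, act (g * h)%g x = act g (act h x) &
      smooth_map2 L S S act].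

(** * Quaternionic structures *)

(* R^(4n) = H^n: the coordinates of a row are the 4 x n real components of a
   column of quaternions, listed as all real parts, then all i-parts, etc. *)
Definition quaternionic_col (R : realType) (n : nat) (v : 'rV[R]_(4 * n)) :
    'cV[quaternion R]_n :=
  let V : 'M[R]_(4, n) := vec_mx v in
  \col_i Quaternion (V (inord 0) i) (V (inord 1) i)
                    (V (inord 2) i) (V (inord 3) i).

(* GL(n, H).H^*, as matrices acting on rows of R^(4n). *)
Definition GLnH_Hstar (R : realType) (n : nat) : set 'M[R]_(4 * n) :=
  [set h | exists (A : 'M[quaternion R]_n) (q : quaternion R),
     [/\ exists A', A *m A' = 1%:M /\ A' *m A = 1%:M,
         q != 0 &
         forall v : 'rV[R]_(4 * n),
           quaternionic_col (v *m h) =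
           \col_i ((A *m quaternionic_col v) i 0 * q)]].

(* [qfibre x] is the fibre at [x] of the subbundle of the frame bundle. A frame
   is an isomorphism R^(4n) -> T_xM, and [h] in GL(4n, R) acts on it by
   precomposition: with one vector per row, this is [h *m F c]. *)
Record almost_quaternionic (R : realType) (n : nat) (M : topologicalType)
    (S : manifold R (4 * n) M) : Type := AlmostQuaternionic {
  qfibre : M -> set (chart R (4 * n) M -> 'M[R]_(4 * n));
  qfibre_frame : forall x F, qfibre x F -> is_frame S x F;
  qfibre_orbit : forall x F, qfibre x F ->
    qfibre x = [set (fun c => h *m F c) | h in @GLnH_Hstar R n];
  qfibre_local_section : forall x, exists U s,
    [/\ open U, U x, forall y, U y -> qfibre y (s y) &
        smooth_tangent_field S U s] }.

(* The frame of coordinate vector fields of [c] has components [1%:M] in [c]. *)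
Definition quaternionic_integrable (R : realType) (n : nat) (M : topologicalType)
    (S : manifold R (4 * n) M) (B : almost_quaternionic S) : Prop :=
  forall x, exists2 c, chart_at S x c &
    forall y, dom c y -> exists2 F, qfibre B y F & F c = 1%:M.

Definition quaternionic_automorphism (R : realType) (n : nat)
    (M : topologicalType) (S : manifold R (4 * n) M)
    (B : almost_quaternionic S) (f : M -> M) : Prop :=
  [/\ smooth_map S S f,
      exists f', [/\ smooth_map S S f', cancel f f' & cancel f' f] &
      forall x F F', is_frame S x F -> is_frame S (f x) F' ->
        differential_maps S S f x F F' -> (qfibre B x F <-> qfibre B (f x) F')].

(* Main.v *)
(* In an integrable chart, the fundamental field of an element of g is a vector
   field V on a ball of H^n whose differential lies everywhere in the Lie algebra
   gl(n, H) + H of GL(n, H).H^*. The first prolongation of this algebra is the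
   dual of H^n and the second one vanishes, so V is a quadratic polynomial
   V(h) = b + Ah - hd - hgh. This is the velocity of a one-parameter group of
   projective transformations of HP^n, generated by the matrix (d, g; b, A), which
   is unique once the real part of its trace is 0. By uniqueness this matrix
   depends linearly on the element of g, and it is compatible with brackets
   because fundamental fields and projective fields both are, with the same sign.
   If the fundamental fields vanished at every point, then all orbit maps would be
   locally constant and the identity component would act trivially; so one of them
   is nonzero at some point, and the representation read off around that point is
   non-trivial. *)

(* The tangent space of GL(n, H).H^* is never computed. Membership of T in gl(n, H) + H is expressed
   by the equation T(vp) = T(v)p + v d(p), where d(p) is read off from one coordinate of T on a
   fixed unit column. This equation follows by differentiating at the identity a polynomial relation
   valid on the group, so any curve in the group serves and no exponential map is involved. It is
   also real-linear in T with coefficients independent of the point, so it survives differentiation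
   of the vector field; this is how second and third derivatives become elements of the
   prolongations. Non-commutativity of H does the algebraic work: ij - ji = 2k is invertible. The
   argument is therefore uniform in n and includes n = 1, where GL(1, H).H^* is a linear conformal
   group of R^4. Fundamental fields are likewise partial derivatives of the action in product
   charts, not velocities of flows. Their bracket relation comes from act (gh) x = act g (act h x),
   differentiated once in h and once in g. *)
Require Import Defs.
From HB Require Import structures.
From mathcomp Require Import all_boot all_order all_algebra.
From mathcomp Require Import ring lra.
From mathcomp Require Import all_classical all_reals all_analysis.
Import Order.TTheory GRing.Theory Num.Theory numFieldNormedType.Exports.

Set Implicit Arguments.
Unset Strict Implicit.
Unset Printing Implicit Defensive.

Local Open Scope classical_set_scope.
Local Open Scope ring_scope.

(** * Quaternions *)

(* Pushes the four components inside by conversion; rewriting with the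
   corresponding equations is slow, as matching unfolds the operations of H. *)
Ltac quat_push := repeat match goal with
  | |- context [qre (?x + ?y)] => change (qre (x + y)) with (qre x + qre y)
  | |- context [qi (?x + ?y)] => change (qi (x + y)) with (qi x + qi y)
  | |- context [qj (?x + ?y)] => change (qj (x + y)) with (qj x + qj y)
  | |- context [qk (?x + ?y)] => change (qk (x + y)) with (qk x + qk y)
  | |- context [qre (- ?x)] => change (qre (- x)) with (- qre x)
  | |- context [qi (- ?x)] => change (qi (- x)) with (- qi x)
  | |- context [qj (- ?x)] => change (qj (- x)) with (- qj x)
  | |- context [qk (- ?x)] => change (qk (- x)) with (- qk x)
  | |- context [qre (?x * ?y)] => change (qre (x * y)) with
      (qre x * qre y - qi x * qi y - qj x * qj y - qk x * qk y)
  | |- context [qi (?x * ?y)] => change (qi (x * y)) with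
      (qre x * qi y + qi x * qre y + qj x * qk y - qk x * qj y)
  | |- context [qj (?x * ?y)] => change (qj (x * y)) with
      (qre x * qj y - qi x * qk y + qj x * qre y + qk x * qi y)
  | |- context [qk (?x * ?y)] => change (qk (x * y)) with
      (qre x * qk y + qi x * qj y - qj x * qi y + qk x * qre y)
  | |- context [@qre ?T 0] => change (@qre T 0) with (0 : T)
  | |- context [@qi ?T 0] => change (@qi T 0) with (0 : T)
  | |- context [@qj ?T 0] => change (@qj T 0) with (0 : T)
  | |- context [@qk ?T 0] => change (@qk T 0) with (0 : T)
  | |- context [@qre ?T 1] => change (@qre T 1) with (1 : T)
  | |- context [@qi ?T 1] => change (@qi T 1) with (0 : T)
  | |- context [@qj ?T 1] => change (@qj T 1) with (0 : T)
  | |- context [@qk ?T 1] => change (@qk T 1) with (0 : T)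
  end.

Ltac quat_components e :=
  move: (f_equal (@qre _) e) (f_equal (@qi _) e)
    (f_equal (@qj _) e) (f_equal (@qk _) e); quat_push.

Lemma quaternion_eqP (R : Type) (x y : quaternion R) : qre x = qre y ->
  qi x = qi y -> qj x = qj y -> qk x = qk y -> x = y.
Proof. by case: x => ? ? ? ?; case: y => ? ? ? ? /= -> -> -> ->. Qed.

Ltac qring := apply: quaternion_eqP; quat_push; rewrite /=; ring.
Ltac qfield := apply: quaternion_eqP; quat_push; rewrite /=; field.

Section Quaternions.
Variable R : realType.
Local Notation H := (quaternion R).
Local Notation "a %:H" := (quaternion_of_real a) (at level 2, format "a %:H").
Implicit Types x y z p q : H.

Definition quat_i : H := Quaternion 0 1 0 0.
Definition quat_j : H := Quaternion 0 0 1 0.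
Definition quat_k : H := Quaternion 0 0 0 1.
Definition quat_conj x : H := Quaternion (qre x) (- qi x) (- qj x) (- qk x).
Definition quat_norm2 x : R := qre x ^+ 2 + qi x ^+ 2 + qj x ^+ 2 + qk x ^+ 2.

Lemma mul_quat_conj x : x * quat_conj x = (quat_norm2 x)%:H.
Proof. by rewrite /quat_norm2; qring. Qed.

Lemma mul_conj_quat x : quat_conj x * x = (quat_norm2 x)%:H.
Proof. by rewrite /quat_norm2; qring. Qed.

Lemma quat_norm2_eq0 x : quat_norm2 x = 0 -> x = 0.
Proof.
move=> /eqP; rewrite /quat_norm2 !paddr_eq0 ?addr_ge0 ?sqr_ge0 //.
by rewrite !sqrf_eq0 => /andP[/andP[/andP[/eqP ? /eqP ?] /eqP ?] /eqP ?];
  apply: quaternion_eqP.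
Qed.

Lemma quat_realM (a b : R) : (a * b)%:H = a%:H * b%:H.
Proof. by qring. Qed.

Lemma quat_realC (a : R) x : a%:H * x = x * a%:H.
Proof. by qring. Qed.

Lemma quat_inverse x : x != 0 -> exists2 y, x * y = 1 & y * x = 1.
Proof.
move=> x0; have n0 : quat_norm2 x != 0.
  by apply: contra_neq x0; exact: quat_norm2_eq0.
exists (quat_conj x * (quat_norm2 x)^-1%:H).
  by rewrite mulrA mul_quat_conj -quat_realM divff.
by rewrite -quat_realC -mulrA mul_conj_quat -quat_realM mulVf.
Qed.

Lemma quat_mulf_eq0 x y : x * y = 0 -> x = 0 \/ y = 0.
Proof.
have [->|x0] := eqVneq x 0; first by left.
move=> xy; right; have [z _ zx] := quat_inverse x0.
by rewrite -[y]mul1r -zx -mulrA xy mulr0.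
Qed.

Lemma quat_central x : (forall y, x * y = y * x) -> x = (qre x)%:H.
Proof.
move=> xC; quat_components (xC quat_i); quat_components (xC quat_j) => /= *.
by apply: quaternion_eqP => /=; lra.
Qed.

End Quaternions.

(** * Prolongations of gl(n, H) + H *)

(* The right H-module H^n is axiomatized by its coordinates [c]: unification
   gets stuck at once on abstract vectors, but not on quaternionic matrices. *)
Section FirstProlongation.
Variables (R : realType) (V : zmodType) (I : Type).
Local Notation H := (quaternion R).
Variables (rscale : V -> H -> V) (c : I -> V -> H) (e0 : V) (i0 : I).
Local Notation "v ** p" := (rscale v p) (at level 40, left associativity).
Implicit Types (p r : H) (u v w : V) (l : I).

Hypothesis coord_inj : forall u v, (forall l, c l u = c l v) -> u = v.
Hypothesis coordD : forall l u v, c l (u + v) = c l u + c l v.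
Hypothesis coord_rscale : forall l v p, c l (v ** p) = c l v * p.
Hypothesis coord_e0 : c i0 e0 = 1.

Let rscaleM v p r : v ** (p * r) = v ** p ** r.
Proof. by apply: coord_inj => l; rewrite !coord_rscale mulrA. Qed.

Let rscaleDl u v p : (u + v) ** p = u ** p + v ** p.
Proof. by apply: coord_inj => l; rewrite !(coord_rscale, coordD) mulrDl. Qed.

Let rscaleDr v p r : v ** (p + r) = v ** p + v ** r.
Proof. by apply: coord_inj => l; rewrite !(coord_rscale, coordD) mulrDr. Qed.

Let coord0 l : c l 0 = 0.
Proof. by apply: (@addrI _ (c l 0)); rewrite addr0 -coordD addr0. Qed.

Let rscale_e0_inj p r : e0 ** p = e0 ** r -> p = r.
Proof. by move=> /(f_equal (c i0)); rewrite !coord_rscale coord_e0 !mul1r. Qed.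

(* [abs_defect T] is the derivation p |-> T(vp) - T(v)p of H attached to an element
   T of the Lie algebra gl(n, H) + H; reading it off from [e0] makes it linear
   in T. *)
Definition abs_defect (T : V -> V) p : H := c i0 (T (e0 ** p)) - c i0 (T e0) * p.

Variable S : V -> V -> V.
Hypothesis SC : forall u v, S u v = S v u.
Hypothesis SD : forall u v w, S u (v + w) = S u v + S u w.
Local Notation d u p := (abs_defect (S u) p).
Hypothesis Sq : forall u v p, S u (v ** p) = S u v ** p + v ** d u p.

Let SDl u v w : S (u + v) w = S u w + S v w.
Proof. by rewrite SC SD (SC w u) (SC w v). Qed.

Let defectD u v p : d (u + v) p = d u p + d v p.
Proof. by rewrite /abs_defect !SDl !coordD mulrDl opprD addrACA. Qed.

(** The inverse of ij - ji = 2k, by which [half_commutator] divides on the right. *)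
Let h : H := Quaternion 0 0 0 (- 2^-1).

Let half_commutator (s e g : H) :
  s * quat_i R * quat_j R + e = s * quat_j R * quat_i R + g -> s = (g - e) * h.
Proof.
move=> eg; have -> : g - e = s * quat_i R * quat_j R - s * quat_j R * quat_i R.
  by apply/eqP; rewrite subr_eq addrAC eq_sym subr_eq eg addrC.
by rewrite /h; qfield.
Qed.

(** Obtained by solving S(ui, uj) = S(uj, ui) for S(u, u). Expanding both sides with [Sq] leaves
    S(u, u)(ij - ji) on one side and u times a quaternion on the other. *)
Definition prolong_form u : H :=
  (d u (quat_j R) * quat_i R + d (u ** quat_j R) (quat_i R)
   - (d u (quat_i R) * quat_j R + d (u ** quat_i R) (quat_j R))) * h.
Local Notation f := prolong_form.

Let prolong_formD u v : f (u + v) = f u + f v.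
Proof.
have gen (a b q r a' b' q' r' x y z : H) :
    ((a + a') * x + (b + b') - ((q + q') * y + (r + r'))) * z =
    (a * x + b - (q * y + r)) * z + (a' * x + b' - (q' * y + r')) * z.
  by qring.
by rewrite /prolong_form !rscaleDl !defectD gen.
Qed.

Let prolong_diag u : S u u = u ** f u.
Proof.
apply: coord_inj => l; rewrite coord_rscale /prolong_form mulrA.
have gen (x a b q e p r : H) :
  x * q * p + x * e - (x * a * r + x * b) = x * (q * p + e - (a * r + b)).
  by qring.
have key p r : c l (S u u) * p * r + (c l u * d u p * r + c l u * d (u ** p) r) =
    c l (S u u) * r * p + (c l u * d u r * p + c l u * d (u ** r) p).
  have e1 a b : c l (S (u ** a) (u ** b)) =
      c l (S u u) * a * b + (c l u * d u a * b + c l u * d (u ** a) b).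
    by rewrite Sq (SC _ u) Sq rscaleDl !coordD !coord_rscale addrA.
  by rewrite -!e1 SC.
by rewrite -gen; exact: half_commutator (key _ _).
Qed.

Let prolong_polar u v : S u v + S u v = u ** f v + v ** f u.
Proof.
have := prolong_diag (u + v); rewrite prolong_formD SD !SDl (SC v u).
rewrite !prolong_diag rscaleDl !rscaleDr => e.
apply: (@addrI _ (u ** f u)); apply: (@addIr _ (v ** f v)).
by move: e; rewrite !addrA.
Qed.

(** Compares two values of 2 S(u, up): one from S(u, u) = u f(u) and [Sq], the other from
    [prolong_polar]. A nonzero coordinate of u is then cancelled. *)
Let prolong_defect u p : (exists l, c l u != 0) ->
  d u p + d u p = f (u ** p) + p * f u - (f u * p + f u * p).
Proof.
case=> l ul; have := prolong_polar u (u ** p); rewrite Sq prolong_diag.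
move=> /(f_equal (c l)); rewrite !coordD !coord_rscale.
move: (d u p) (f u) (f (u ** p)) (c l u) ul => x y z a an0 e.
have : a * (x + x - (z + p * y - (y * p + y * p))) = 0.
  have -> : a * (x + x - (z + p * y - (y * p + y * p))) =
    (a * y * p + a * x) + (a * y * p + a * x) - (a * z + a * p * y) by qring.
  by rewrite e subrr.
by case/quat_mulf_eq0 => /eqP; rewrite ?(negPf an0) // subr_eq0 => /eqP.
Qed.

(** The same comparison for 2 S(u, vp). With g(v) = f(vp) - f(v)p, the failure of right linearity,
    it becomes u g(v) = v g(u). *)
Let prolong_exchange u v p : (exists l, c l u != 0) ->
  u ** (f (v ** p) - f v * p) = v ** (f (u ** p) - f u * p).
Proof.
move=> u0; have du := prolong_defect p u0.
have := prolong_polar u (v ** p); rewrite Sq => e; apply: coord_inj => l.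
have := prolong_polar u v => /(f_equal (c l)).
move/(f_equal (c l)): e; rewrite !coordD !coord_rscale => e1 e2.
move: e1 e2 du.
move: (d u p) (f (v ** p)) (f v) (f (u ** p)) (f u) (c l u) (c l v) (c l (S u v)).
move=> x a b a' b' ul vl s e1 e2 du.
have e3 : vl * (x + x) + (s + s) * p = ul * a + vl * p * b'.
  by rewrite -e1; qring.
move: e3; rewrite e2 du => e3; apply/eqP; rewrite -subr_eq0.
rewrite -(subrr (ul * a + vl * p * b')) -{2}e3; apply/eqP.
by qring.
Qed.

Let prolong_form_linear v p : f (v ** p) = f v * p.
Proof.
have e0n0 q : q != 0 -> exists l, c l (e0 ** q) != 0.
  by move=> q0; exists i0; rewrite coord_rscale coord_e0 mul1r.
have e01 : exists l, c l e0 != 0 by exists i0; rewrite coord_e0 oner_neq0.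
pose g v := f (v ** p) - f v * p.
have ge a : g (e0 ** a) = a * g e0.
  have := prolong_exchange (e0 ** a) p e01; rewrite -[RHS]rscaleM.
  exact: rscale_e0_inj.
have jn0 : quat_j R != 0.
  by apply/eqP => /(f_equal (@qj R)) /=; apply/eqP; rewrite oner_neq0.
(* Exchanging e0 i with e0 j gives ji g(e0) = ij g(e0), and ij - ji is invertible. This works even
   if all vectors are multiples of e0. *)
have g0 : g e0 = 0.
  have := prolong_exchange (e0 ** quat_i R) p (e0n0 _ jn0).
  rewrite -/(g _) -/(g (e0 ** quat_j R)) !ge -[LHS]rscaleM -[RHS]rscaleM => /rscale_e0_inj.
  move: (g e0) => x e; quat_components e => /= *.
  by apply: quaternion_eqP => /=; lra.
have := prolong_exchange v p e01; rewrite -/(g v) -/(g e0) g0.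
move=> /(f_equal (c i0)); rewrite !coord_rscale coord_e0 mul1r mulr0 => /eqP.
by rewrite subr_eq0 => /eqP.
Qed.

(* The first prolongation of gl(n, H) + H is the dual of H^n. *)
Lemma abs_first_prolongation : exists f : V -> H,
  [/\ forall u v, f (u + v) = f u + f v, forall u p, f (u ** p) = f u * p &
      forall u v, S u v + S u v = u ** f v + v ** f u].
Proof. by exists f; split. Qed.

End FirstProlongation.

Section SecondProlongation.
Variables (R : realType) (V : zmodType) (I : Type).
Local Notation H := (quaternion R).
Variables (rscale : V -> H -> V) (c : I -> V -> H).
Local Notation "v ** p" := (rscale v p) (at level 40, left associativity).
Implicit Types (p r : H) (u v w : V) (l : I).

Hypothesis coord_inj : forall u v, (forall l, c l u = c l v) -> u = v.
Hypothesis coordD : forall l u v, c l (u + v) = c l u + c l v.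
Hypothesis coord_rscale : forall l v p, c l (v ** p) = c l v * p.

(** The case n = 1. Taking u = w = 1 gives 2 phi(v) = v phi(1) + phi(1) v, and a few triples of
    units then force phi(1) = 0. *)
Let quaternionic_line (phi : H -> H) :
  (forall u v w : H, v * phi u * w + w * phi u * v = u * phi v * w + w * phi v * u) ->
  forall v : H, phi v = 0.
Proof.
move=> h; have h1 (v : H) : v * phi 1 + phi 1 * v = phi v + phi v.
  by have := h 1 v 1; rewrite !mulr1 !mul1r.
have h2 (v w : H) : phi v * w + w * phi v = v * phi 1 * w + w * phi 1 * v.
  by have := h 1 v w; rewrite mul1r mulr1.
suff c0 : phi 1 = 0.
  move=> v; have := h1 v; rewrite c0 mulr0 mul0r add0r.
  move: (phi v) => x e; quat_components e => /= *.
  by apply: quaternion_eqP => /=; lra.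
have := (h1 (quat_i R), h1 (quat_j R), h2 (quat_i R) (quat_j R),
  h2 (quat_i R) (quat_k R), h2 (quat_j R) (quat_i R),
  h (quat_i R) (quat_j R) (quat_i R)).
move: (phi 1) (phi (quat_i R)) (phi (quat_j R)) => x y z [[[[[e1 e2] e3] e4] e5] e6].
quat_components e1; quat_components e2; quat_components e3; quat_components e4.
quat_components e5; quat_components e6 => /= *.
by apply: quaternion_eqP => /=; lra.
Qed.

(** By the first prolongation, an element of the second one has the form 2 S_u(v, w) = v f(u, w) + w
    f(u, v), where u is the additional direction of differentiation; [f_sym] says that u and v can
    be exchanged. *)
Variable f : V -> V -> H.
Hypothesis fZ : forall u v p, f u (v ** p) = f u v * p.
Hypothesis f_sym : forall u v w,
  v ** f u w + w ** f u v = u ** f v w + w ** f v u.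

Let coord0 l : c l 0 = 0.
Proof. by apply: (@addrI _ (c l 0)); rewrite addr0 -coordD addr0. Qed.

Let zero_or_unit u : u = 0 \/ exists l, c l u != 0.
Proof.
have [[l ul]|nl] := pselect (exists l, c l u != 0); first by right; exists l.
left; apply: coord_inj => l; rewrite coord0; apply/eqP.
by apply: contrapT => /negP ul; apply: nl; exists l.
Qed.

Let form0 u : f u 0 = 0.
Proof.
have <- : 0 ** 0 = 0 :> V; last by rewrite fZ mulr0.
by apply: coord_inj => l; rewrite coord_rscale coord0 mul0r.
Qed.

Let form_line e l (v : H) : c l e != 0 -> f (e ** v) e = 0.
Proof.
move=> el; apply: (quaternionic_line (phi := fun p => f (e ** p) e)) => u {}v w.
have /(f_equal (c l)) := f_sym (e ** u) (e ** v) (e ** w).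
rewrite !coordD !coord_rscale !fZ => h; apply/eqP; rewrite -subr_eq0.
move: (f _ e) (f _ e) (c l e) el h => x y a an0 h; apply/eqP.
have /quat_mulf_eq0 [/eqP|->//] :
    a * (v * y * w + w * y * v - (u * x * w + w * x * u)) = 0.
  by rewrite mulrBr !mulrDr !mulrA; rewrite !mulrA in h; rewrite h subrr.
by rewrite (negPf an0).
Qed.

(** Puts v = w = e in [f_sym], where f(e, e) = 0 by [form_line]. Used in both orders of the
    arguments, it yields 4 f(u, v) = f(u, v). *)
Let form_swap u e l : c l e != 0 -> f u e + f u e = f e u.
Proof.
move=> el; have /(f_equal (c l)) := f_sym u e e.
have fee : f e e = 0.
  have {1}-> : e = e ** 1 by apply: coord_inj => k; rewrite coord_rscale mulr1.
  exact: form_line el.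
rewrite fee !coordD !coord_rscale mulr0 add0r -mulrDr => /eqP.
rewrite -subr_eq0 -mulrBr => /eqP/quat_mulf_eq0[/eqP|/eqP].
  by rewrite (negPf el).
by rewrite subr_eq0 => /eqP.
Qed.

(* The second prolongation of gl(n, H) + H vanishes. *)
Lemma abs_second_prolongation u v : f u v = 0.
Proof.
have [->|[l vl]] := zero_or_unit v; first exact: form0.
have := form_swap u vl.
have [->|[k uk]] := zero_or_unit u.
  rewrite form0; move: (f 0 v) => x e; quat_components e => /= *.
  by apply: quaternion_eqP => /=; lra.
move: (form_swap v uk); move: (f u v) (f v u) => x y <- e.
by quat_components e => /= *; apply: quaternion_eqP => /=; quat_push; lra.
Qed.

End SecondProlongation.

(** * Derivations of H and the matrix form of gl(n, H) + H *)

Section Structure.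
Variable R : realType.
Local Notation H := (quaternion R).
Local Notation "a %:H" := (quaternion_of_real a) (at level 2, format "a %:H").

Lemma quat_derivation_inner (d : H -> H) :
  (forall p r, d (p + r) = d p + d r) -> (forall p r, d (p * r) = d p * r + p * d r) ->
  (forall a : R, d a%:H = 0) -> exists q, forall p, d p = p * q - q * p.
Proof.
move=> dD dM d0.
(* If d(p) = pq - qp with q imaginary, then d(i)i + d(j)j + d(k)k = 4q. *)
pose q := 4^-1%:H * (d (quat_i R) * quat_i R + d (quat_j R) * quat_j R + d (quat_k R) * quat_k R).
have dp p : d p = (qi p)%:H * d (quat_i R) + (qj p)%:H * d (quat_j R) + (qk p)%:H * d (quat_k R).
  have {1}-> : p = (qre p)%:H + (qi p)%:H * quat_i R + (qj p)%:H * quat_j R + (qk p)%:H * quat_k R.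
    by qring.
  by rewrite !dD !dM !d0 !mul0r !add0r.
have nd p r : p * r = (- 1)%:H -> d p * r + p * d r = 0 by move=> e; rewrite -dM e d0.
have ii : d (quat_i R) * quat_i R + quat_i R * d (quat_i R) = 0 by apply: nd; qring.
have jj : d (quat_j R) * quat_j R + quat_j R * d (quat_j R) = 0 by apply: nd; qring.
have kk : d (quat_k R) * quat_k R + quat_k R * d (quat_k R) = 0 by apply: nd; qring.
have ij : d (quat_k R) = d (quat_i R) * quat_j R + quat_i R * d (quat_j R).
  by rewrite -dM; congr d; qring.
have ji : d (quat_j R) * quat_i R + quat_j R * d (quat_i R) + d (quat_k R) = 0.
  rewrite -dM -dD -[RHS](d0 0); congr d; qring.
exists q => p; rewrite dp /q.
move: {dD dM d0 dp nd q} (d (quat_i R)) (d (quat_j R)) (d (quat_k R)) ii jj kk ij ji.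
move=> x y z ii jj kk ij ji.
have [xi xj xk] : [/\ qi x = 0, qi y = - qj x & qi z = - qk x].
  quat_components ii; quat_components ij; quat_components ji => /= *.
  by split; lra.
have [yi yj yk] : [/\ qj y = 0, qj z = - qk y & qk z = 0].
  quat_components ii; quat_components jj; quat_components kk; quat_components ij; quat_components ji => /= *.
  by split; lra.
have [xr yr zr] : [/\ qre x = 0, qre y = 0 & qre z = 0].
  quat_components ii; quat_components jj; quat_components kk => /= *.
  by split; lra.
by apply: quaternion_eqP; quat_push; rewrite /= xi xj xk yi yj yk xr yr zr; field.
Qed.

Variable n : nat.
Local Notation "v ** p" := (v *m (p : H)%:M) (at level 40, left associativity).
Implicit Types (p r : H) (u v w : 'cV[H]_n).

Lemma rscaleE v p l : (v ** p) l 0 = v l 0 * p.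
Proof. by rewrite mxE big_ord1 mxE eqxx. Qed.

Lemma addcolE u v l : (u + v) l 0 = u l 0 + v l 0.
Proof. by rewrite mxE. Qed.

Lemma col_ext u v : (forall l, u l 0 = v l 0) -> u = v.
Proof. by move=> e; apply/colP. Qed.

Definition unit_col (i : 'I_n) : 'cV[H]_n := delta_mx i 0.

Lemma unit_colE i l : unit_col i l 0 = (l == i)%:R.
Proof. by rewrite mxE eqxx andbT. Qed.

Lemma unit_col1 i : unit_col i i 0 = 1.
Proof. by rewrite unit_colE eqxx. Qed.

Lemma col_sum_unit v : v = \sum_i unit_col i ** v i 0.
Proof.
apply/colP => l; rewrite summxE (bigD1 l) //= rscaleE unit_col1 mul1r.
rewrite big1 ?addr0 // => i il; rewrite rscaleE unit_colE eq_sym (negPf il).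
by rewrite mul0r.
Qed.

Definition defect (i0 : 'I_n) : ('cV[H]_n -> 'cV[H]_n) -> H -> H :=
  abs_defect (fun v p => v ** p) (fun l v => v l 0) (unit_col i0) i0.

(* T belongs to gl(n, H) + H, see [quasi_linear_structure]. *)
Definition quasi_linear (i0 : 'I_n) (T : 'cV[H]_n -> 'cV[H]_n) : Prop :=
  forall v p, T (v ** p) = T v ** p + v ** defect i0 T p.

Lemma first_prolongation i0 (S : 'cV[H]_n -> 'cV[H]_n -> 'cV[H]_n) :
  (forall u v, S u v = S v u) -> (forall u v w, S u (v + w) = S u v + S u w) ->
  (forall u, quasi_linear i0 (S u)) ->
  exists f : 'cV[H]_n -> H,
  [/\ forall u v, f (u + v) = f u + f v, forall u p, f (u ** p) = f u * p &
      forall u v, S u v + S u v = u ** f v + v ** f u].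
Proof.
move=> SC SD Sq.
have := @abs_first_prolongation R 'cV[H]_n 'I_n (fun v p => v ** p)
  (fun l v => v l 0) (unit_col i0) i0 col_ext (fun l u v => addcolE u v l)
  (fun l v p => rscaleE v p l) (unit_col1 i0) S SC SD.
by apply => u v p; exact: Sq.
Qed.

Lemma second_prolongation (f : 'cV[H]_n -> 'cV[H]_n -> H) :
  (forall u v p, f u (v ** p) = f u v * p) ->
  (forall u v w, v ** f u w + w ** f u v = u ** f v w + w ** f v u) ->
  forall u v, f u v = 0.
Proof.
exact: (@abs_second_prolongation R 'cV[H]_n 'I_n (fun v p => v ** p)
  (fun l v => v l 0) col_ext (fun l u v => addcolE u v l)
  (fun l v p => rscaleE v p l) f).
Qed.

Lemma form_row (f : 'cV[H]_n -> H) :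
  (forall u v, f (u + v) = f u + f v) -> (forall u p, f (u ** p) = f u * p) ->
  exists xi : 'rV[H]_n, forall v, (f v)%:M = xi *m v.
Proof.
move=> fD fZ; exists (\row_i f (unit_col i)) => v; rewrite {1}(col_sum_unit v).
have f0 : f 0 = 0 by apply: (@addrI _ (f 0)); rewrite addr0 -fD addr0.
rewrite (big_morph f fD f0).
apply/matrixP => i j; rewrite !ord1 [LHS]mxE eqxx mulr1n mxE.
by apply: eq_bigr => l _; rewrite fZ mxE.
Qed.

(** The defect is a derivation of H, hence p |-> pq - qp for some q. Then v |-> T(v) - vq commutes
    with right multiplication by H, so it is a matrix; its column j is T(e_j) - e_j q. *)
Lemma quasi_linear_structure i0 (T : 'cV[H]_n -> 'cV[H]_n) :
  (forall u v, T (u + v) = T u + T v) -> (forall v (a : R), T (v ** a%:H) = T v ** a%:H) ->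
  quasi_linear i0 T ->
  exists A q, forall v, T v = A *m v + v ** q.
Proof.
move=> TD TZ Tq; pose d := defect i0 T.
have injE p r : unit_col i0 ** p = unit_col i0 ** r -> p = r.
  by move=> /colP/(_ i0); rewrite !rscaleE unit_col1 !mul1r.
have dD p r : d (p + r) = d p + d r.
  apply: injE; rewrite [in RHS]raddfD /= mulmxDr.
  apply: (@addrI _ (T (unit_col i0) ** (p + r))); rewrite -Tq.
  by rewrite raddfD /= !mulmxDr TD !Tq addrACA.
have dM p r : d (p * r) = d p * r + p * d r.
  apply: injE; rewrite [in RHS]raddfD /= mulmxDr.
  apply: (@addrI _ (T (unit_col i0) ** (p * r))); rewrite -Tq.
  by rewrite !scalar_mxM !mulmxA Tq Tq mulmxDl addrA.
have d0 a : d a%:H = 0.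
  apply: injE; apply: (@addrI _ (T (unit_col i0) ** a%:H)); rewrite -Tq TZ.
  by rewrite raddf0 mulmx0 addr0.
have [q dE] := quat_derivation_inner dD dM d0.
pose B := \matrix_(i, j) T (unit_col j) i 0.
exists (B - q%:M), q => v.
have T0 : T 0 = 0 by apply: (@addrI _ (T 0)); rewrite addr0 -TD addr0.
rewrite {1}(col_sum_unit v) (big_morph T TD T0); apply: col_ext => l.
rewrite summxE addcolE mulmxBl rscaleE mxE [X in _ = _ + X + _]mxE.
under eq_bigr => i _ do rewrite Tq addcolE !rscaleE -/(d _) dE unit_colE.
rewrite big_split /= [X in _ + X = _](bigD1 l) //= eqxx mul1r.
rewrite [X in _ + (_ + X)]big1 ?addr0 => [|i il]; last first.
  by rewrite eq_sym (negPf il) mul0r.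
rewrite [X in _ = X - _ + _]mxE; under [in RHS]eq_bigr => i _ do rewrite mxE.
have -> : (q%:M *m v) l 0 = q * v l 0.
  rewrite mxE (bigD1 l) //= big1 ?addr0 => [|i il]; rewrite mxE.
    by rewrite eqxx.
  by rewrite eq_sym (negPf il) mul0r.
by rewrite -!addrA; congr (_ + _); rewrite addrC.
Qed.

End Structure.

(** * Directional derivatives and smoothness *)

Section Differentiability.
Variable R : realType.

Lemma near_eq_differentiable (V W : normedModType R) (f g : V -> W) (x : V) :
  (\near x, f x = g x) -> differentiable f x -> differentiable g x.
Proof.
move=> fg /diff_locallyP[dc df]; have fgx : f x = g x := nbhs_singleton fg.
have dg : g \o shift x = cst (g x) + 'd f x +o_ 0 id.
  apply/eqaddoP => e e0; have /eqaddoP/(_ e e0) := df.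
  apply: filterS2; last by move: fg; rewrite (near_shift 0); exact.
  by move=> h /=; rewrite subr0 !fctE /= fgx => ->.
by apply/diff_locallyP; rewrite (diff_unique dc dg).
Qed.

Lemma differentiable_mulmxr m p (A : 'M[R]_(m, p)) (x : 'rV[R]_m) :
  differentiable (mulmxr A : 'rV[R]_m -> 'rV[R]_p) x.
Proof.
have -> : (mulmxr A : 'rV[R]_m -> 'rV[R]_p) = \sum_i (fun v : 'rV[R]_m => v 0 i *: row i A).
  by apply/funext => v; rewrite /= fct_sumE mulmx_sum_row.
apply: differentiable_sum => i.
by apply: differentiableZl; exact: differentiable_coord.
Qed.

Lemma continuous_mulmxr m p (A : 'M[R]_(m, p)) :
  continuous (mulmxr A : 'rV[R]_m -> 'rV[R]_p).
Proof. by move=> x; apply: differentiable_continuous; exact: differentiable_mulmxr. Qed.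

Lemma differentiable_affine m p (a : 'rV[R]_p) (A : 'M[R]_(m, p)) (x : 'rV[R]_m) :
  differentiable (fun y : 'rV[R]_m => a + y *m A) x.
Proof.
have -> : (fun y : 'rV[R]_m => a + y *m A) = cst a + mulmxr A by apply/funext.
by apply: differentiableD; [exact: differentiable_cst|exact: differentiable_mulmxr].
Qed.

Lemma derive_affine (V : normedModType R) m p (f : 'rV[R]_p -> V) (a : 'rV[R]_p)
    (A : 'M[R]_(m, p)) (v y : 'rV[R]_m) :
  'D_v (fun y => f (a + y *m A)) y = 'D_(v *m A) f (a + y *m A).
Proof.
rewrite /derive; set F := (fun _ : R => _); set G := (fun _ : R => _).
suff -> : F = G by []; apply/funext => h; rewrite /F /G /=.
by rewrite mulmxDl -scalemxAl addrCA.
Qed.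

Lemma derive_mulmxr (V : normedModType R) m p (f : V -> 'rV[R]_m) (A : 'M[R]_(m, p)) v x :
  differentiable f x -> 'D_v (fun y => f y *m A) x = 'D_v f x *m A.
Proof.
move=> df; have dA := differentiable_mulmxr A (f x).
rewrite -[(fun y => f y *m A)]/(mulmxr A \o f) !deriveE //.
  by rewrite diff_comp //= diff_lin //; exact: continuous_mulmxr.
exact: differentiable_comp.
Qed.

Lemma derive_coord (V : normedModType R) m (f : V -> 'rV[R]_m) v x i :
  differentiable f x -> 'D_v (fun y => f y 0 i) x = 'D_v f x 0 i.
Proof. by move=> /diff_derivable df; rewrite derive_mx // mxE. Qed.

Lemma differentiable_coordf (V : normedModType R) m (f : V -> 'rV[R]_m) x i :
  differentiable f x -> differentiable (fun y => f y 0 i) x.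
Proof. by move=> df; exact: (differentiable_comp df (differentiable_coord _ _ _)). Qed.

Lemma derive_linearD (V W : normedModType R) (f : V -> W) x u v :
  differentiable f x -> 'D_(u + v) f x = 'D_u f x + 'D_v f x.
Proof. by move=> df; rewrite !deriveE // linearD. Qed.

Lemma derive_linearZ (V W : normedModType R) (f : V -> W) x (a : R) v :
  differentiable f x -> 'D_(a *: v) f x = a *: 'D_v f x.
Proof. by move=> df; rewrite !deriveE // linearZ. Qed.

Lemma is_derive_line (V W : normedModType R) (f : V -> W) a v (s : R) :
  differentiable f (a + s *: v) ->
  is_derive s 1 (fun s : R => f (a + s *: v)) ('D_v f (a + s *: v)).
Proof.
move=> df; have e : (fun h : R => h^-1 *: (((fun s : R => f (a + s *: v)) \o shift s) h%:A - f (a + s *: v))) =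
  (fun h => h^-1 *: ((f \o shift (a + s *: v)) (h *: v) - f (a + s *: v))).
  apply/funext => h /=; congr (_ *: (f _ - _)).
  by rewrite [h%:A]mulr1 scalerDl addrCA.
by split; rewrite /derivable /derive e //; exact: diff_derivable.
Qed.

Lemma line_in_ball (V : normedModType R) (x h : V) (r s : R) : ball x r (x + h) ->
  0 <= s -> s <= 1 -> ball x r (x + s *: h).
Proof.
rewrite -!ball_normE /= !opprD !addNKr !normrN => hr s0 s1.
by rewrite normrZ ger0_norm // (le_lt_trans _ hr) // ler_piMl.
Qed.

Lemma MVT_line (V : normedModType R) (f : V -> R) a v (t : R) : 0 <= t ->
  (forall s, 0 <= s <= t -> differentiable f (a + s *: v)) ->
  exists2 s, 0 <= s <= t & f (a + t *: v) - f a = 'D_v f (a + s *: v) * t.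
Proof.
move=> t0 df; pose g s := f (a + s *: v).
have dg s : 0 <= s <= t -> is_derive s 1 g ('D_v f (a + s *: v)).
  by move=> st; apply: is_derive_line; exact: df.
have [||s] := MVT_segment t0 (f := g) (df := fun s => 'D_v f (a + s *: v)).
- by move=> s; rewrite in_itv /= => /andP[/ltW s0 /ltW s1]; apply: dg; rewrite s0.
- apply: derivable_within_continuous => s; rewrite in_itv /= => st.
  by have [] := dg s st.
by rewrite in_itv /= /g scale0r addr0 subr0; exists s.
Qed.

Lemma derive_zero_ball (V : normedModType R) (f : V -> R) x r :
  (forall y, ball x r y -> differentiable f y) ->
  (forall y v, ball x r y -> 'D_v f y = 0) -> forall y, ball x r y -> f y = f x.
Proof.
move=> df d0 y; rewrite -[y](subrKC x); set h := y - x => yr.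
have seg s : 0 <= s <= 1 -> ball x r (x + s *: h) by move=> /andP[]; exact: line_in_ball.
have [s s01] := MVT_line (f := f) (a := x) (v := h) ler01 (fun s s01 => df _ (seg s s01)).
by rewrite scale1r d0 ?mul0r; [move/eqP; rewrite subr_eq0 => /eqP|exact: seg].
Qed.

(** * Symmetry of second derivatives *)

Section Schwarz.
(** The derivatives are named functions constrained on U, so that they can be instantiated with
    coordinates of vector-valued derivatives. *)
Variables (V : normedModType R) (U : set V) (f fv fw fvw fwv : V -> R) (v w x : V).
Hypotheses (Uo : open U) (Ux : U x).
Hypothesis df : forall y, U y -> differentiable f y.
Hypothesis dfv : forall y, U y -> 'D_v f y = fv y /\ differentiable fv y.
Hypothesis dfvw : forall y, U y -> 'D_w fv y = fvw y.
Hypothesis dfw : forall y, U y -> 'D_w f y = fw y /\ differentiable fw y.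
Hypothesis dfwv : forall y, U y -> 'D_v fw y = fwv y.
Hypothesis cvw : {for x, continuous fvw}.
Hypothesis cwv : {for x, continuous fwv}.

(** The second difference of g over a parallelogram, by the mean value theorem first along a and
    then along b. The two orders give the two mixed derivatives at points close to x. *)
Lemma schwarz_square (g gv : V -> R) (a b : V) (t : R) : 0 <= t ->
  (forall s r, 0 <= s <= t -> 0 <= r <= t -> U (x + s *: a + r *: b)) ->
  (forall y, U y -> differentiable g y) ->
  (forall y, U y -> 'D_a g y = gv y /\ differentiable gv y) ->
  exists s r, [/\ 0 <= s <= t, 0 <= r <= t &
   g (x + t *: a + t *: b) - g (x + t *: a) - (g (x + t *: b) - g x) =
   'D_b gv (x + s *: a + r *: b) * t * t].
Proof.
move=> t0 sq dg dgv; have tt : 0 <= t <= t by rewrite t0 lexx.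
have z0 : 0 <= (0 : R) <= t by rewrite lexx t0.
pose G y := g (y + t *: b) - g y.
have shiftE y : differentiable (fun y : V => y + t *: b) y.
  by apply: differentiableD; [exact: ex_diff|exact: differentiable_cst].
have dG s : 0 <= s <= t -> differentiable G (x + s *: a) /\
    'D_a G (x + s *: a) = gv (x + s *: a + t *: b) - gv (x + s *: a).
  move=> st; have U1 := sq s t st tt; have := sq s 0 st z0; rewrite scale0r addr0 => U2.
  have d1 : differentiable (g \o (fun y => y + t *: b)) (x + s *: a).
    by apply: differentiable_comp; [exact: shiftE|exact: dg].
  have d2 := dg _ U2; split; first exact: differentiableB.
  rewrite deriveB ?(dgv _ U2).1; [|exact: diff_derivable..].
  rewrite -(dgv _ U1).1; congr (_ - _).
  rewrite /derive; set F := (fun _ : R => _); set G' := (fun _ : R => _).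
  by suff -> : F = G' by []; apply/funext => h; rewrite /F /G' /= -!addrA.
have [s st es] := MVT_line t0 (fun s st => (dG s st).1).
have [r rt er] := MVT_line (f := gv) (a := x + s *: a) (v := b) t0
   (fun r rt => (dgv _ (sq s r st rt)).2).
exists s, r; split => //; by rewrite -er -(dG s st).2 -es.
Qed.

Lemma schwarz_scalar : fvw x = fwv x.
Proof.
apply/eqP; rewrite -subr_eq0 -normr_le0; apply/ler_addgt0Pr => e e0; rewrite add0r.
have e2 : 0 < e / 2 by rewrite divr_gt0.
have near_x : \forall y \near x, [/\ U y, `|fvw x - fvw y| < e / 2 & `|fwv x - fwv y| < e / 2].
  near=> y; split.
  - by near: y; exact: open_nbhs_nbhs.
  - by near: y; move/cvgrPdist_lt : cvw; exact.
  - by near: y; move/cvgrPdist_lt : cwv; exact.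
have /nbhs_ballP[r /= r0 xr] := near_x.
(* Keeps the parallelogram spanned by tv and tw inside the ball of radius r; the summand 1 makes the
   denominator positive. *)
pose t := r / 2 / (1 + `|v| + `|w|).
have n0 : 0 < 1 + `|v| + `|w| by rewrite -addrA ltr_pwDl // addr_ge0.
have t0 : 0 < t by rewrite !divr_gt0.
have inb s q : 0 <= s <= t -> 0 <= q <= t -> ball x r (x + s *: v + q *: w).
  move=> /andP[s0 st] /andP[q0 qt]; rewrite -ball_normE /= -addrA opprD addNKr normrN.
  rewrite (le_lt_trans (ler_normD _ _)) // !normrZ !ger0_norm //.
  have : t * (`|v| + `|w|) < r.
    rewrite /t mulrAC ltr_pdivrMr // (@lt_le_trans _ _ (r * (`|v| + `|w| + 1))) //.
      rewrite mulrAC ltr_pdivrMr //.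
      by have := ler_wpM2l (ltW r0) (addr_ge0 (normr_ge0 v) (normr_ge0 w)); nra.
    by rewrite ler_wpM2l ?(ltW r0) // addrC addrA.
  apply: le_lt_trans; rewrite mulrDr lerD // ler_wpM2r //.
have [s [q [st qt e1]]] := schwarz_square (ltW t0) (fun s q hs hq =>
  let: And3 h _ _ := xr _ (inb s q hs hq) in h) df dfv.
have inb' q' s' : 0 <= q' <= t -> 0 <= s' <= t -> ball x r (x + q' *: w + s' *: v).
  by move=> hq hs; rewrite addrAC; exact: inb.
have [q' [s' [qt' st' e2']]] := schwarz_square (ltW t0) (fun q s hq hs =>
  let: And3 h _ _ := xr _ (inb' q s hq hs) in h) df dfw.
have [U1 c1 _] := xr _ (inb s q st qt); have [U2 _ c2] := xr _ (inb' q' s' qt' st').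
rewrite (dfvw U1) in e1; rewrite (dfwv U2) in e2'.
have E : fvw (x + s *: v + q *: w) = fwv (x + q' *: w + s' *: v).
  apply: (mulIf (lt0r_neq0 t0)); apply: (mulIf (lt0r_neq0 t0)).
  by rewrite -e1 -e2' addrAC (addrAC x); ring.
rewrite E in c1; apply: ltW; rewrite (splitr e).
rewrite -(subrKA (fwv (x + q' *: w + s' *: v))) (le_lt_trans (ler_normD _ _)) //.
by rewrite ltrD // distrC.
Unshelve. all: by end_near. Qed.

End Schwarz.

(** On the segment f2 is constant and f1 is affine, so f differs from the quadratic polynomial by a
    function of derivative 0, and there is no remainder. *)
Lemma taylor2_line (V : normedModType R) (f f1 f2 : V -> R) (x h : V) :
  (forall s : R, 0 <= s <= 1 -> differentiable f (x + s *: h) /\ 'D_h f (x + s *: h) = f1 (x + s *: h)) ->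
  (forall s : R, 0 <= s <= 1 -> differentiable f1 (x + s *: h) /\ 'D_h f1 (x + s *: h) = f2 (x + s *: h)) ->
  (forall s : R, 0 <= s <= 1 -> differentiable f2 (x + s *: h) /\ 'D_h f2 (x + s *: h) = 0) ->
  f (x + h) = f x + f1 x + 2^-1 * f2 x.
Proof.
move=> d0 d1 d2.
have c2 (s : R) : 0 <= s <= 1 -> f2 (x + s *: h) = f2 x.
  move=> /andP[s0 s1]; have [|r /andP[r0 rs] e] := MVT_line (f := f2) (a := x) (v := h) s0.
    by move=> r /andP[r0 rs]; apply: (d2 r _).1; rewrite r0 (le_trans rs).
  apply/eqP; rewrite -subr_eq0 e (d2 r _).2 ?mul0r //.
  by rewrite r0 (le_trans rs).
have c1 (s : R) : 0 <= s <= 1 -> f1 (x + s *: h) = f1 x + s * f2 x.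
  move=> /andP[s0 s1]; have [|r /andP[r0 rs] e] := MVT_line (f := f1) (a := x) (v := h) s0.
    by move=> r /andP[r0 rs]; apply: (d1 r _).1; rewrite r0 (le_trans rs).
  have r01 : 0 <= r <= 1 by rewrite r0 (le_trans rs).
  by move/eqP: e; rewrite subr_eq (d1 r r01).2 c2 // => /eqP ->; rewrite addrC mulrC.
pose g (s : R) := f (x + s *: h) - (s * f1 x + 2^-1 * s ^+ 2 * f2 x).
have dg (s : R) : 0 <= s <= 1 -> is_derive s 1 g 0.
  move=> s01; have i0 := @is_derive_line V R f x h s (d0 s s01).1.
  have i1 : is_derive s 1 (fun s : R => s * f1 x + 2^-1 * s ^+ 2 * f2 x) (f1 x + s * f2 x).
    have -> : (fun s : R => s * f1 x + 2^-1 * s ^+ 2 * f2 x) =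
        f1 x *: id + (2^-1 * f2 x) *: (id ^+ 2).
      by apply/funext => r; rewrite !fctE /= /GRing.scale /=; ring.
    apply: (is_derive_eq (is_deriveD (is_deriveZ (f1 x) (is_derive_id s 1))
      (is_deriveZ (2^-1 * f2 x) (is_deriveX 2 (is_derive_id s 1))))).
    by rewrite /= expr1 /GRing.scale /= !mulr1; field.
  have := is_deriveB i0 i1; rewrite (d0 s s01).2 c1 // subrr.
  exact.
have [||s s01 e] := MVT_segment ler01 (f := g) (df := fun=> 0).
- by move=> s; rewrite in_itv /= => /andP[/ltW s0 /ltW s1]; apply: dg; rewrite s0.
- apply: derivable_within_continuous => s; rewrite in_itv /= => st.
  by have [] := dg s st.
move/eqP: e; rewrite mul0r subr_eq0 /g scale1r scale0r !addr0 => /eqP e.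
have -> : f (x + h) = f (x + h) - (1 * f1 x + 2^-1 * 1 ^+ 2 * f2 x) + (f1 x + 2^-1 * f2 x).
  by rewrite !mul1r expr1n mulr1 subrK.
by rewrite e expr2 !(mul0r, mulr0, addr0, subr0) addrA.
Qed.

End Differentiability.

Lemma near_open (T : topologicalType) (U : set T) (P : T -> Prop) (x : T) :
  open U -> U x -> (forall y, U y -> P y) -> \forall y \near x, P y.
Proof. by move=> Uo Ux h; exact: filterS h (open_nbhs_nbhs (conj Uo Ux)). Qed.

(** * Functions of class C^r on open sets *)

Section SmoothOn.
Variable R : realType.

Lemma Cr_onW m (V : normedModType R) r (U U' : set 'rV[R]_m) (f : 'rV[R]_m -> V) :
  U' `<=` U -> Cr_on r U f -> Cr_on r U' f.
Proof.
move=> UU; elim: r f => [|r IH] f /=; first by move=> h x /UU /h.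
by case=> df h; split=> [x /UU /df //|v]; apply: IH.
Qed.

Lemma smooth_onW m (V : normedModType R) (U U' : set 'rV[R]_m) (f : 'rV[R]_m -> V) :
  U' `<=` U -> smooth_on U f -> smooth_on U' f.
Proof. by move=> UU h r; apply: Cr_onW (h r). Qed.

Lemma smooth_on_differentiable m (V : normedModType R) (U : set 'rV[R]_m)
  (f : 'rV[R]_m -> V) x : smooth_on U f -> U x -> differentiable f x.
Proof. by move=> /(_ 1%N) [h _] /h. Qed.

Lemma smooth_on_derive m (V : normedModType R) (U : set 'rV[R]_m)
  (f : 'rV[R]_m -> V) v : smooth_on U f -> smooth_on U ('D_v f).
Proof. by move=> h r; have [_ /(_ v)] := h r.+1. Qed.

Lemma Cr_on_eq m (V : normedModType R) r (U : set 'rV[R]_m) (f g : 'rV[R]_m -> V) :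
  open U -> (forall x, U x -> f x = g x) -> Cr_on r U f -> Cr_on r U g.
Proof.
move=> Uo; elim: r f g => [|r IH] f g fg /=.
  move=> h x Ux; rewrite /prop_for /continuous_at -(fg x Ux); apply: cvg_trans (h x Ux).
  have nx : \forall y \near x, f y = g y.
    by near=> y; rewrite fg //; near: y; exact: open_nbhs_nbhs.
  exact: near_eq_cvg nx.
have nfg x : U x -> \near x, f x = g x.
  by move=> Ux; near=> y; apply: fg; near: y; exact: open_nbhs_nbhs.
case=> df h; split=> [x Ux|v].
  by apply: near_eq_differentiable (df x Ux); exact: nfg.
by apply: IH (h v) => x Ux; exact: near_eq_derive (nfg x Ux).
Unshelve. all: by end_near. Qed.

Lemma smooth_on_eq m (V : normedModType R) (U : set 'rV[R]_m) (f g : 'rV[R]_m -> V) :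
  open U -> (forall x, U x -> f x = g x) -> smooth_on U f -> smooth_on U g.
Proof. by move=> Uo fg h r; apply: Cr_on_eq Uo fg (h r). Qed.

Lemma Cr_on_affine (V : normedModType R) m p r (U : set 'rV[R]_p) (f : 'rV[R]_p -> V)
    (a : 'rV[R]_p) (A : 'M[R]_(m, p)) :
  Cr_on r U f -> Cr_on r [set y | U (a + y *m A)] (fun y : 'rV[R]_m => f (a + y *m A)).
Proof.
elim: r f => [|r IH] f /=.
  move=> h x /h fx.
  have ca := differentiable_continuous (differentiable_affine a A x).
  exact: (@continuous_comp _ _ _ (fun y : 'rV[R]_m => a + y *m A) f x ca fx).
case=> df h; split=> [x /df dfx|v].
  exact: (differentiable_comp (differentiable_affine _ _ _) dfx).
have -> : 'D_v (fun y : 'rV[R]_m => f (a + y *m A)) =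
    (fun y => 'D_(v *m A) f (a + y *m A)) by apply/funext => y; exact: derive_affine.
exact: (IH ('D_(v *m A) f) (h _)).
Qed.

Lemma smooth_on_affine (V : normedModType R) m p (U : set 'rV[R]_p) (f : 'rV[R]_p -> V)
    (a : 'rV[R]_p) (A : 'M[R]_(m, p)) :
  smooth_on U f -> smooth_on [set y | U (a + y *m A)] (fun y : 'rV[R]_m => f (a + y *m A)).
Proof. by move=> h r; exact: (Cr_on_affine a A (h r)). Qed.

Lemma smooth_on_derive_comm m p (U : set 'rV[R]_m) (f : 'rV[R]_m -> 'rV[R]_p) v w x :
  open U -> U x -> smooth_on U f -> 'D_w ('D_v f) x = 'D_v ('D_w f) x.
Proof.
move=> Uo Ux sf.
have sv := smooth_on_derive v sf; have sw := smooth_on_derive w sf.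
have svw := smooth_on_derive w sv; have swv := smooth_on_derive v sw.
have df := fun y => smooth_on_differentiable (x := y) sf.
have dv := fun y => smooth_on_differentiable (x := y) sv.
have dw := fun y => smooth_on_differentiable (x := y) sw.
have cont g : smooth_on U g -> forall i, {for x, continuous (fun y => (g y : 'rV[R]_p) 0 i)}.
  move=> sg i; apply: differentiable_continuous; apply: differentiable_coordf.
  exact: smooth_on_differentiable sg Ux.
apply/rowP => i.
have h1 y : U y -> differentiable (fun y => f y 0 i) y.
  by move=> Uy; apply: differentiable_coordf; exact: df.
have h2 y : U y -> 'D_v (fun y => f y 0 i) y = 'D_v f y 0 i /\
    differentiable (fun y => 'D_v f y 0 i) y.
  move=> Uy; split; first by rewrite derive_coord //; exact: df.
  by apply: differentiable_coordf; exact: dv.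
have h3 y : U y -> 'D_w (fun y => 'D_v f y 0 i) y = 'D_w ('D_v f) y 0 i.
  by move=> Uy; rewrite derive_coord //; exact: dv.
have h4 y : U y -> 'D_w (fun y => f y 0 i) y = 'D_w f y 0 i /\
    differentiable (fun y => 'D_w f y 0 i) y.
  move=> Uy; split; first by rewrite derive_coord //; exact: df.
  by apply: differentiable_coordf; exact: dw.
have h5 y : U y -> 'D_v (fun y => 'D_w f y 0 i) y = 'D_v ('D_w f) y 0 i.
  by move=> Uy; rewrite derive_coord //; exact: dw.
exact: (schwarz_scalar Uo Ux h1 h2 h3 h4 h5 (cont _ svw i) (cont _ swv i)).
Qed.

Lemma derive_zero_ball_rV m p (f : 'rV[R]_m -> 'rV[R]_p) x r :
  (forall y, ball x r y -> differentiable f y) ->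
  (forall y v, ball x r y -> 'D_v f y = 0) -> forall y, ball x r y -> f y = f x.
Proof.
move=> df d0 y xy; apply/rowP => i.
apply: (@derive_zero_ball _ _ (fun y => f y 0 i) x r) => // z => [xz|v xz].
  by apply: differentiable_coordf; exact: df.
by rewrite derive_coord ?d0 ?mxE //; exact: df.
Qed.

Lemma taylor2_ball m p (f : 'rV[R]_m -> 'rV[R]_p) x h r : smooth_on (ball x r) f ->
  ball x r (x + h) -> (forall y, ball x r y -> 'D_h ('D_h ('D_h f)) y = 0) ->
  f (x + h) = f x + 'D_h f x + 2^-1 *: 'D_h ('D_h f) x.
Proof.
move=> sf xh d3; apply/rowP => i; rewrite !mxE.
have seg (s : R) : 0 <= s <= 1 -> ball x r (x + s *: h).
  by move=> /andP[]; exact: line_in_ball.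
have sf1 := smooth_on_derive h sf; have sf2 := smooth_on_derive h sf1.
apply: (@taylor2_line R _ (fun y => f y 0 i) (fun y => 'D_h f y 0 i)
  (fun y => 'D_h ('D_h f) y 0 i)) => s /seg xs.
- have d := smooth_on_differentiable sf xs.
  by rewrite derive_coord //; split => //; exact: differentiable_coordf.
- have d := smooth_on_differentiable sf1 xs.
  by rewrite derive_coord //; split => //; exact: differentiable_coordf.
- have d := smooth_on_differentiable sf2 xs.
  by rewrite derive_coord // d3 // mxE; split => //; exact: differentiable_coordf.
Qed.

End SmoothOn.

(** * Infinitesimal automorphisms of the flat structure *)

Section QuaternionicCoordinates.
Variables (R : realType) (n : nat).
Local Notation H := (quaternion R).
Local Notation E := 'rV[R]_(4 * n).
Local Notation "a %:H" := (quaternion_of_real a) (at level 2, format "a %:H").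
Local Notation "v ** p" := (v *m (p : H)%:M) (at level 40, left associativity).
Local Notation Q := (@quaternionic_col R n).

Definition real_row (w : 'cV[H]_n) : E :=
  mxvec (\matrix_(a < 4, i < n) match val a with
    | 0%N => qre (w i 0) | 1%N => qi (w i 0) | 2%N => qj (w i 0) | _ => qk (w i 0)
    end).
Local Notation Qi := real_row.

Lemma quaternionic_colE v i : Q v i 0 =
  Quaternion (vec_mx v (inord 0) i) (vec_mx v (inord 1) i)
             (vec_mx v (inord 2) i) (vec_mx v (inord 3) i).
Proof. by rewrite mxE. Qed.

Lemma real_rowK : cancel Qi Q.
Proof.
move=> w; apply/colP => i; rewrite mxE /Qi mxvecK.
by apply: quaternion_eqP; rewrite /= mxE /= inordK.
Qed.

Lemma quaternionic_colK : cancel Q Qi.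
Proof.
move=> v; rewrite /Qi -[RHS]vec_mxK; congr mxvec; apply/matrixP => a i.
rewrite mxE; case: a => -[|[|[|[|//]]]] lt /=; rewrite mxE /=.
all: by congr (vec_mx v _ _); apply: val_inj; rewrite /= inordK.
Qed.

Lemma quaternionic_colD u v : Q (u + v) = Q u + Q v.
Proof.
apply/colP => i; rewrite addcolE !quaternionic_colE raddfD.
by apply: quaternion_eqP; rewrite /= mxE.
Qed.

Lemma quaternionic_colZ (a : R) v : Q (a *: v) = Q v ** a%:H.
Proof.
apply/colP => i; rewrite rscaleE !quaternionic_colE linearZ.
by apply: quaternion_eqP; quat_push; rewrite /= mxE; ring.
Qed.

Lemma quaternionic_col0 : Q 0 = 0.
Proof. by apply: (@addrI _ (Q 0)); rewrite addr0 -quaternionic_colD addr0. Qed.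

Lemma quaternionic_colN u : Q (- u) = - Q u.
Proof. by apply/eqP; rewrite -subr_eq0 opprK -quaternionic_colD addNr quaternionic_col0. Qed.

Lemma real_rowD u v : Qi (u + v) = Qi u + Qi v.
Proof. by apply: (can_inj quaternionic_colK); rewrite quaternionic_colD !real_rowK. Qed.

Lemma real_rowN u : Qi (- u) = - Qi u.
Proof. by apply: (can_inj quaternionic_colK); rewrite quaternionic_colN !real_rowK. Qed.

Lemma real_rowZ (a : R) v : Qi (v ** a%:H) = a *: Qi v.
Proof. by apply: (can_inj quaternionic_colK); rewrite quaternionic_colZ !real_rowK. Qed.

Lemma linear_mx m p (L : 'rV[R]_m -> 'rV[R]_p) :
  (forall a u v, L (a *: u + v) = a *: L u + L v) -> exists M, forall z, L z = z *m M.
Proof.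
move=> Llin; pose f : {linear 'rV[R]_m -> 'rV[R]_p} := HB.pack L (GRing.isLinear.Build _ _ _ _ L Llin).
by exists (lin1_mx f) => z; rewrite mul_rV_lin1.
Qed.

Lemma rscale_realC (v : 'cV[H]_n) p (a : R) : v ** (p * a%:H) = v ** p ** a%:H.
Proof. by rewrite scalar_mxM mulmxA. Qed.

Lemma quaternionic_linear_mx (F : 'cV[H]_n -> 'cV[H]_n) :
  (forall u v, F (u + v) = F u + F v) -> (forall (a : R) u, F (u ** a%:H) = F u ** a%:H) ->
  exists M, forall z, Qi (F (Q z)) = z *m M.
Proof.
move=> FD FZ; apply: linear_mx => a u v.
by rewrite quaternionic_colD quaternionic_colZ FD FZ real_rowD real_rowZ.
Qed.

Lemma real_scalar_mxC p q (X : 'M[H]_(p, q)) (a : R) : (a%:H)%:M *m X = X *m (a%:H)%:M.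
Proof.
apply/matrixP => i j; rewrite mul_scalar_mx mxE [RHS]mxE (bigD1 j) //= mxE eqxx.
rewrite big1 ?addr0 ?quat_realC // => k kj; rewrite mxE (negPf kj).
exact: mulr0.
Qed.

Lemma double_inj (W : lmodType R) (a b : W) : a + a = b + b -> a = b.
Proof.
move=> e; have dE (c : W) : c = (2 : R)^-1 *: (c + c).
  by rewrite -mulr2n -[c *+ 2]scaler_nat scalerA mulVf ?scale1r // pnatr_eq0.
by rewrite (dE a) (dE b) e.
Qed.

Lemma col_double_inj (u v : 'cV[H]_n) : u + u = v + v -> u = v.
Proof.
move=> e; apply: (can_inj real_rowK); apply: double_inj.
exact: (etrans (esym (real_rowD u u)) (etrans (f_equal Qi e) (real_rowD v v))).
Qed.

Lemma rscaleBr (v : 'cV[H]_n) p r : v ** (p - r) = v ** p - v ** r.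
Proof. by rewrite raddfB mulmxBr. Qed.

Variable i0 : 'I_n.

(* The differential of V at y is [quasi_linear], i.e. lies in gl(n, H) + H. *)
Definition infinitesimal_auto (V : E -> E) (y : E) : Prop :=
  forall v p, Q ('D_(Qi (v ** p)) V y) = Q ('D_(Qi v) V y) ** p +
    v ** (Q ('D_(Qi (unit_col R i0 ** p)) V y) i0 0 -
          Q ('D_(Qi (unit_col R i0)) V y) i0 0 * p).

(** The condition is a real-linear relation, with constant matrices, among the derivatives of V in
    four fixed directions. In this form it can be differentiated in y. *)
Lemma infinitesimal_auto_mx (v : 'cV[H]_n) p :
  exists M1 M2 M3 : 'M[R]_(4 * n, 4 * n), forall a b c d : E,
  Q a = Q b ** p + v ** (Q c i0 0 - Q d i0 0 * p) <->
  a = b *m M1 + (c *m M2 - d *m M3).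
Proof.
have [M1 M1E] : exists M, forall z, Qi (Q z ** p) = z *m M.
  apply: (quaternionic_linear_mx (F := fun u => u ** p)) => [u u'|a u].
    exact: mulmxDl.
  by rewrite -rscale_realC -quat_realC scalar_mxM mulmxA.
have [M2 M2E] : exists M, forall z, Qi (v ** Q z i0 0) = z *m M.
  apply: (quaternionic_linear_mx (F := fun u => v ** u i0 0)) => [u u'|a u].
    by rewrite addcolE raddfD /= mulmxDr.
  by rewrite rscaleE rscale_realC.
have [M3 M3E] : exists M, forall z, Qi (v ** (Q z i0 0 * p)) = z *m M.
  apply: (quaternionic_linear_mx (F := fun u => v ** (u i0 0 * p))) => [u u'|a u].
    by rewrite addcolE mulrDl raddfD /= mulmxDr.
  by rewrite rscaleE -[RHS]rscale_realC -!mulrA quat_realC.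
exists M1, M2, M3 => a b c d; rewrite -M1E -M2E -M3E.
have -> : Qi (Q b ** p) + (Qi (v ** Q c i0 0) - Qi (v ** (Q d i0 0 * p))) =
    Qi (Q b ** p + v ** (Q c i0 0 - Q d i0 0 * p)).
  by rewrite rscaleBr (real_rowD (Q b ** p)) (real_rowD (v ** _)) real_rowN.
by split=> [<-|->]; rewrite ?quaternionic_colK ?real_rowK.
Qed.

Lemma derive_relation (fa fb fc fd : E -> E) (M1 M2 M3 : 'M[R]_(4 * n, 4 * n)) w y :
  differentiable fb y -> differentiable fc y -> differentiable fd y ->
  (\forall z \near y, fa z = fb z *m M1 + (fc z *m M2 - fd z *m M3)) ->
  'D_w fa y = 'D_w fb y *m M1 + ('D_w fc y *m M2 - 'D_w fd y *m M3).
Proof.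
move=> db dc dd rel; rewrite (near_eq_derive w rel).
have dM f (M : 'M[R]_(4 * n, 4 * n)) : differentiable f y ->
    is_derive y w (fun z => (f z : E) *m M) ('D_w f y *m M).
  move=> df; split; last exact: derive_mulmxr.
  exact: (diff_derivable (differentiable_comp df (differentiable_mulmxr M _))).
by have [_ ->] := is_deriveD (dM _ M1 db) (is_deriveB (dM _ M2 dc) (dM _ M3 dd)).
Qed.

Variables (U : set E) (Uo : open U).

Lemma infinitesimal_auto_derive (V : E -> E) w y : smooth_on U V ->
  (forall y, U y -> infinitesimal_auto V y) -> U y -> infinitesimal_auto ('D_w V) y.
Proof.
move=> sV aV Uy v p; have [M1 [M2 [M3 ME]]] := infinitesimal_auto_mx v p.
apply/ME; have rel z (Uz : U z) := (ME _ _ _ _).1 (aV z Uz v p).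
move: rel; move: (Qi (v ** p)) (Qi v) (Qi (unit_col R i0 ** p)) (Qi (unit_col R i0)).
move=> a b c d rel.
have dif u : differentiable ('D_u V) y.
  exact: smooth_on_differentiable (smooth_on_derive u sV) Uy.
have swap u : 'D_u ('D_w V) y = 'D_w ('D_u V) y.
  exact: (smooth_on_derive_comm w u Uo Uy sV).
have key := derive_relation w (dif b) (dif c) (dif d) (near_open Uo Uy rel).
have combine (a' b' c' d' a1 b1 c1 d1 : E) : a' = a1 -> b' = b1 -> c' = c1 -> d' = d1 ->
  a1 = b1 *m M1 + (c1 *m M2 - d1 *m M3) -> a' = b' *m M1 + (c' *m M2 - d' *m M3).
  by move=> -> -> -> ->.
exact: (combine _ _ _ _ _ _ _ _ (swap a) (swap b) (swap c) (swap d) key).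
Qed.

(** The second derivative at y lies in the first prolongation: it is symmetric, and freezing u gives
    the differential of D_u V, which is again an infinitesimal automorphism. *)
Lemma second_derivative_form (V : E -> E) y : smooth_on U V ->
  (forall y, U y -> infinitesimal_auto V y) -> U y ->
  exists f : 'cV[H]_n -> H,
  [/\ forall u v, f (u + v) = f u + f v, forall u p, f (u ** p) = f u * p &
      forall u v, Q ('D_(Qi v) ('D_(Qi u) V) y) + Q ('D_(Qi v) ('D_(Qi u) V) y)
        = u ** f v + v ** f u].
Proof.
move=> sV aV Uy.
apply: (@first_prolongation R n i0 (fun u v => Q ('D_(Qi v) ('D_(Qi u) V) y))).
- by move=> u v; rewrite (smooth_on_derive_comm _ _ Uo Uy sV).
- move=> u v w; rewrite real_rowD derive_linearD ?quaternionic_colD //.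
  exact: smooth_on_differentiable (smooth_on_derive _ sV) Uy.
- by move=> u; exact: infinitesimal_auto_derive.
Qed.

(** For each z, the second derivative of D_z V gives a form f z. As the derivatives along x and z
    commute, these forms have the symmetry required by [second_prolongation]. *)
Lemma third_derivative_zero (V : E -> E) y a b c : smooth_on U V ->
  (forall y, U y -> infinitesimal_auto V y) -> U y -> 'D_a ('D_b ('D_c V)) y = 0.
Proof.
move=> sV aV Uy.
have /choice[f fP] : forall z : 'cV[H]_n, exists f : 'cV[H]_n -> H,
  [/\ forall u v, f (u + v) = f u + f v, forall u p, f (u ** p) = f u * p &
      forall u v, Q ('D_(Qi v) ('D_(Qi u) ('D_(Qi z) V)) y) +
        Q ('D_(Qi v) ('D_(Qi u) ('D_(Qi z) V)) y) = u ** f v + v ** f u].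
  move=> z; exact: (second_derivative_form (smooth_on_derive (Qi z) sV)
    (fun y' Uy' => infinitesimal_auto_derive (Qi z) sV aV Uy') Uy).
have f0 u v : f u v = 0.
  apply: second_prolongation => [x z p|x z w]; first by have [_ ->] := fP x.
  have [_ _ <-] := fP x; have [_ _ <-] := fP z.
  have e := near_eq_derive (Qi w) (near_open Uo Uy (fun t Ut =>
    smooth_on_derive_comm (Qi x) (Qi z) Uo Ut sV)).
  exact: (f_equal (fun t => Q t + Q t) e).
rewrite -[a]quaternionic_colK -[b]quaternionic_colK -[c]quaternionic_colK.
have [_ _ /(_ (Q b) (Q a))] := fP (Q c); rewrite !f0 raddf0 !mulmx0 addr0.
rewrite -quaternionic_colD -quaternionic_col0 => /(can_inj quaternionic_colK) /eqP.
by rewrite -mulr2n -scaler_nat scaler_eq0 pnatr_eq0 /= => /eqP.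
Qed.

End QuaternionicCoordinates.

(** * A Liouville theorem: infinitesimal automorphisms are quadratic *)

Section Liouville.
Variables (R : realType) (n : nat) (i0 : 'I_n).
Local Notation H := (quaternion R).
Local Notation E := 'rV[R]_(4 * n).
Local Notation "v ** p" := (v *m (p : H)%:M) (at level 40, left associativity).
Local Notation Q := (@quaternionic_col R n).
Local Notation Qi := (@real_row R n).

Lemma infinitesimal_auto_quadratic (V : E -> E) (x : E) r : smooth_on (ball x r) V ->
  0 < r -> (forall y, ball x r y -> infinitesimal_auto i0 V y) ->
  exists (A : 'M[H]_n) q (xi : 'rV[H]_n), forall h, ball x r (x + h) ->
    Q (V (x + h)) = Q (V x) + A *m Q h + Q h ** q + Q h *m xi *m Q h.
Proof.
move=> sV r0 aV; have Uo : open (ball x r) by exact: ball_open.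
have xx := ballxx x r0.
have [A [q TE]] : exists A q, forall v, Q ('D_(Qi v) V x) = A *m v + v ** q.
  have dV := smooth_on_differentiable sV xx.
  apply: (@quasi_linear_structure R n i0 (fun v => Q ('D_(Qi v) V x))).
  - by move=> u v; rewrite real_rowD derive_linearD // quaternionic_colD.
  - by move=> v a; rewrite real_rowZ derive_linearZ // quaternionic_colZ.
  - exact: (aV x xx).
have [f [fD fZ fE]] := second_derivative_form Uo sV aV xx.
have [xi xiE] := form_row fD fZ.
(* The second derivative along h is h f(h); the factor 1/2 comes from the Taylor formula and, being
   real, can be moved past the quaternionic column. *)
exists A, q, (xi *m (quaternion_of_real 2^-1)%:M) => h xh.
rewrite (taylor2_ball sV xh); last first.
  by move=> y xy; exact: third_derivative_zero aV xy.
rewrite !quaternionic_colD -!addrA; congr (_ + _); rewrite addrA; congr (_ + _).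
  by rewrite -TE quaternionic_colK.
rewrite quaternionic_colZ mulmxA -mulmxA real_scalar_mxC mulmxA; congr (_ *m _).
have := fE (Q h) (Q h); rewrite !quaternionic_colK xiE mulmxA.
exact: col_double_inj.
Qed.

End Liouville.

(** * Projective vector fields on H^n *)

Section ProjectiveFields.
Variables (R : realType) (n : nat).
Local Notation H := (quaternion R).
Local Notation E := 'rV[R]_(4 * n).
Local Notation "a %:H" := (quaternion_of_real a) (at level 2, format "a %:H").
Local Notation "v ** p" := (v *m (p : H)%:M) (at level 40, left associativity).
Local Notation Q := (@quaternionic_col R n).
Local Notation Qi := (@real_row R n).
Implicit Types (M N : 'M[H]_(1 + n)) (h w : 'cV[H]_n).

(* The velocity of the action of exp(tM) on the affine chart h |-> [1 : h] of
   the quaternionic projective space. *)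
Definition projective_field M h : 'cV[H]_n :=
  row_mx (- h) 1%:M *m M *m col_mx 1%:M h.
Local Notation pf := projective_field.

(** The differential of [projective_field M] at h along w, by the product rule. *)
Definition projective_diff M h w : 'cV[H]_n :=
  row_mx (- w) 0 *m M *m col_mx 1%:M h + row_mx (- h) 1%:M *m M *m col_mx 0 w.
Local Notation dpf := projective_diff.

Lemma projective_fieldE (d : 'M[H]_1) (g : 'rV[H]_n) (b : 'cV[H]_n) (A : 'M[H]_n) h :
  pf (block_mx d g b A) h = b + A *m h - h *m d - h *m g *m h.
Proof.
have gen (x y z t : 'cV[H]_n) : - z + y + (- t + x) = y + x - z - t.
  by rewrite [- z + y]addrC [- t + x]addrC addrA; congr (_ - _); rewrite addrAC.
by rewrite /pf mul_row_block mul_row_col !mul1mx mulmx1 !mulNmx mulmxDl mulNmx gen.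
Qed.

Lemma projective_fieldB M N h : pf (M - N) h = pf M h - pf N h.
Proof. by rewrite /pf mulmxBr mulmxBl. Qed.

Lemma projective_fieldD M N h : pf (M + N) h = pf M h + pf N h.
Proof. by rewrite /pf mulmxDr mulmxDl. Qed.

Lemma qreB (x y : H) : qre (x - y) = qre x - qre y.
Proof. by []. Qed.

Lemma qre_sum (I : Type) (r : seq I) (P : pred I) (F : I -> H) :
  qre (\sum_(i <- r | P i) F i) = \sum_(i <- r | P i) qre (F i).
Proof. by apply: (big_morph (@qre R)). Qed.

Lemma qreMC (x y : H) : qre (x * y) = qre (y * x).
Proof. by quat_push; ring. Qed.

(** Over H the trace of a commutator need not vanish, but its real part does, because xy and yx have
    the same real part. *)
Lemma in_sl_commutator m (M N : 'M[H]_m) : in_sl (M *m N - N *m M).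
Proof.
rewrite /in_sl raddfB qreB; apply/eqP; rewrite subr_eq0; apply/eqP.
rewrite /mxtrace !qre_sum.
under eq_bigr => i _ do rewrite mxE qre_sum.
under [RHS]eq_bigr => i _ do rewrite mxE qre_sum.
rewrite exchange_big /=; apply: eq_bigr => i _; apply: eq_bigr => j _.
exact: qreMC.
Qed.

Lemma in_sl_lin m (M N : 'M[H]_m) (a : R) : in_sl M -> in_sl N ->
  in_sl (a%:H *: M + N).
Proof.
rewrite /in_sl raddfD /= linearZ /= => M0 N0.
by rewrite -[LHS]/(qre (a%:H * \tr M) + qre (\tr N)) N0; quat_push => /=; rewrite M0; ring.
Qed.

Lemma in_slB m (M N : 'M[H]_m) : in_sl M -> in_sl N -> in_sl (M - N).
Proof.
move=> M0 N0; rewrite addrC -[M]scale1r.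
have -> : - N + 1 *: M = (-1)%:H *: N + M.
  rewrite scale1r; congr (_ + _); apply/matrixP => i j; rewrite !mxE.
  by apply: quaternion_eqP; quat_push => /=; ring.
exact: in_sl_lin.
Qed.

Lemma in_sl_block (d : 'M[H]_1) (g : 'rV[H]_n) (b : 'cV[H]_n) (A : 'M[H]_n) :
  in_sl (block_mx d g b A : 'M[H]_n.+1) <-> qre (\tr d) + qre (\tr A) = 0.
Proof.
rewrite /in_sl; have := mxtrace_block d g b A.
move: (\tr (block_mx d g b A)) => t ->.
by [].
Qed.

Lemma projective_field_exists (A : 'M[H]_n) q (xi : 'rV[H]_n) (b : 'cV[H]_n) :
  exists M, in_sl (M : 'M[H]_n.+1) /\
    forall h, pf M h = b + A *m h + h ** q + h *m xi *m h.
Proof.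
(* Subtracting a real multiple s of the identity does not change the field, since s commutes with h.
   This s removes the real part of the trace of a matrix of size n + 1. *)
pose s : R := (qre (\tr A) - qre q) / n.+1%:R.
exists (block_mx (- q%:M - (s%:H)%:M) (- xi) b (A - (s%:H)%:M)); split.
  apply/in_sl_block; rewrite !raddfB /= raddfN /= !mxtrace_scalar.
  rewrite -[LHS]/(- qre (q *+ 1) - qre (s%:H *+ 1) + (qre (\tr A) - qre (s%:H *+ n))).
  have -> : qre (s%:H *+ n) = s *+ n by elim: (n) => [//|k IH]; rewrite mulrS [in RHS]mulrS -IH.
  rewrite !mulr1n /= -mulr_natr /s -(natr1 n).
  by field; rewrite natr1 pnatr_eq0.
move=> h; rewrite projective_fieldE mulmxN mulNmx opprK; congr (_ + _).
rewrite mulmxBl mulmxBr mulmxN real_scalar_mxC opprB opprK.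
by rewrite -!addrA addKr.
Qed.

(** The value at h = 0 gives b = 0. The values at th and -th, which can be taken in any ball around
    0, separate the linear from the quadratic terms: Ah = hd and hgh = 0. On multiples of a unit
    column the first identity makes d commute with H, so d is real and A is the same scalar; the
    trace condition makes it 0. *)
Lemma projective_field_inj (i0 : 'I_n) M : in_sl (M : 'M[H]_n.+1) ->
  (forall h, exists2 t : R, t != 0 &
     pf M (h ** t%:H) = 0 /\ pf M (h ** (- t)%:H) = 0) -> M = 0.
Proof.
rewrite -[M]submxK; move: (ulsubmx M) (ursubmx M) (dlsubmx M) (drsubmx M) => d g b A.
move=> tr0 pf0; have b0 : b = 0.
  have [t _ [+ _]] := pf0 0; rewrite mul0mx projective_fieldE.
  by rewrite !mul0mx mulmx0 !subr0 addr0.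
have lin h : A *m h = h *m d /\ h *m g *m h = 0.
  have pfE k : pf (block_mx d g b A) k = A *m k - k *m d - k *m g *m k.
    by rewrite projective_fieldE b0 add0r.
  have [t t0 []] := pf0 h; rewrite (pfE (h ** t%:H)) (pfE (h ** (- t)%:H)).
  have -> : h ** (- t)%:H = - (h ** t%:H).
    rewrite -mulmxN -raddfN /=; congr (_ *m _%:M).
    by apply: quaternion_eqP; quat_push => /=; ring.
  have tI (u : 'cV[H]_n) : u ** t%:H = 0 -> u = 0.
    move=> e; rewrite -[u]mulmx1; have -> : 1%:M = (t%:H)%:M *m (t^-1%:H)%:M :> 'M[H]_1.
      by rewrite -scalar_mxM -quat_realM divff.
    by rewrite mulmxA e mul0mx.
  have gen (x y z : 'cV[H]_n) : x - y - z = 0 -> - x + y - - - z = 0 ->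
      x = y /\ z = 0.
    move=> /subr0_eq e1; rewrite opprK => /subr0_eq e2.
    have z0 : z = 0 by apply: (@col_double_inj R n); rewrite addr0 -{1}e1 -e2 addrACA subrr addNr addr0.
    by split=> //; apply: subr0_eq; rewrite e1.
  have e1 : A *m (h ** t%:H) = A *m h ** t%:H by rewrite mulmxA.
  have e2 : h ** t%:H *m d = h *m d ** t%:H by rewrite -!mulmxA real_scalar_mxC.
  have e3 : h ** t%:H *m g *m (h ** t%:H) = h *m g *m h ** t%:H ** t%:H.
    by rewrite -[h ** t%:H *m g]mulmxA real_scalar_mxC !mulmxA -[_ *m g *m _ *m h]mulmxA real_scalar_mxC !mulmxA.
  rewrite !mulmxN !mulNmx opprK e1 e2 e3 => f1 f2.
  have [f3 f4] := gen _ _ _ f1 f2; split; last by apply: (tI _ (tI _ f4)).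
  by apply: subr0_eq; apply: (tI _ _); rewrite mulmxBl f3 subrr.
have g0 : g = 0.
  apply/rowP => i; have [_ /colP/(_ i)] := lin (unit_col R i).
  rewrite [RHS]mxE => e; rewrite [RHS]mxE -[RHS]e.
  have -> : unit_col R i *m g *m unit_col R i = unit_col R i ** g 0 i.
    rewrite -mulmxA; congr (_ *m _); apply/matrixP => k l; rewrite !ord1.
    rewrite [RHS]mxE eqxx mulr1n mxE (bigD1 i) //= unit_col1 mulr1 big1 ?addr0 // => m mi.
    by rewrite unit_colE (negPf mi) mulr0.
  by rewrite rscaleE unit_col1 mul1r.
have [c dE] : exists c, d = c%:M.
  by exists (d 0 0); apply/matrixP => i j; rewrite !ord1 mxE eqxx mulr1n.
subst d; have Ad i p : A *m (unit_col R i ** p) = unit_col R i ** (c * p).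
  by rewrite mulmxA (lin _).1 scalar_mxM mulmxA.
have cr : c = (qre c)%:H.
  apply: quat_central => x; have := (lin (unit_col R i0 ** x)).1; rewrite Ad.
  by move=> /colP/(_ i0); rewrite !rscaleE unit_col1 !mul1r.
have AE : A = ((qre c)%:H)%:M.
  apply/matrixP => i j; have /colP/(_ i) := (lin (unit_col R j)).1.
  have -> : (A *m unit_col R j) i 0 = A i j.
    rewrite mxE (bigD1 j) //= unit_col1 mulr1 big1 ?addr0 // => k kj.
    by rewrite unit_colE (negPf kj) mulr0.
  by rewrite rscaleE -cr unit_colE => ->; rewrite mxE; case: (i == j); rewrite ?mul1r ?mul0r.
have s0 : qre c = 0.
  move/in_sl_block: tr0; rewrite AE !mxtrace_scalar.
  have qreMn (x : H) k : qre (x *+ k) = qre x *+ k.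
    by elim: k => [//|k IH]; rewrite mulrS [RHS]mulrS -IH.
  rewrite !qreMn mulr1n /= -mulrS => /eqP; rewrite -mulr_natr mulf_eq0 pnatr_eq0 orbF.
  by move=> /eqP.
have c0 : c = 0 by rewrite cr s0.
by rewrite b0 g0 AE -cr c0 !raddf0 block_mx0.
Qed.

(* The matrices col(0, row(-h, 1)) and 1 - col(1, h) row(1, 0) coincide, so that
   the mixed terms of the two differentials cancel. *)
Lemma projective_field_bracket M N h :
  dpf M h (pf N h) - dpf N h (pf M h) = pf (M *m N - N *m M) h.
Proof.
set C : 'M[H]_(1 + n, 1) := col_mx 1%:M h; set P : 'M[H]_(n, 1 + n) := row_mx (- h) 1%:M.
pose e : 'M[H]_(1, 1 + n) := row_mx 1%:M 0.
have w1 w : row_mx (- w) 0 = - (w *m e) by rewrite mul_mx_row mulmx1 mulmx0 opp_row_mx oppr0.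
have w2 w : w = P *m N *m C -> w = P *m N *m C by [].
have PE : col_mx 0 P = 1%:M - C *m e.
  rewrite /P /C /e mul_col_row !mulmx1 !mulmx0 scalar_mx_block opp_block_mx add_block_mx.
  by rewrite subrr !oppr0 !addr0 sub0r /block_mx row_mx0.
have dE K L : dpf K h (pf L h) = P *m K *m L *m C
    - (P *m L *m C *m e *m K *m C + P *m K *m C *m e *m L *m C).
  rewrite /dpf w1 /pf -/C -/P !mulNmx.
  have -> : col_mx 0 (P *m L *m C) = col_mx 0 P *m L *m C :> 'M[H]_(1 + n, 1).
    by rewrite !mul_col_mx !mul0mx.
  rewrite PE !mulmxA mulmxBr mulmx1 !mulmxBl !mulmxA.
  have gen (x y z : 'cV[H]_n) : - x + (y - z) = y - (x + z) by rewrite opprD addrCA.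
  exact: gen.
rewrite !dE /pf -/C -/P mulmxBr mulmxBl !mulmxA.
by rewrite opprB [X in _ + (X - _)]addrC addrA subrK.
Qed.

(** The expansion in t is exact, so [derive_quadratic] reads the differential off as the coefficient
    of t. *)
Lemma projective_field_line M h w (t : R) :
  pf M (h + w ** t%:H) = pf M h + dpf M h w ** t%:H +
    (row_mx (- w) 0 *m M *m col_mx 0 w) ** (t ^+ 2)%:H.
Proof.
have P1 : row_mx (- (h + w ** t%:H)) 1%:M = row_mx (- h) 1%:M + (t%:H)%:M *m row_mx (- w) 0 :> 'M[H]_(n, 1 + n).
  by rewrite mul_mx_row mulmx0 add_row_mx addr0 real_scalar_mxC mulNmx opprD.
have C1 : col_mx 1%:M (h + w ** t%:H) = col_mx 1%:M h + col_mx 0 w *m (t%:H)%:M :> 'M[H]_(1 + n, 1).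
  by rewrite mul_col_mx mul0mx add_col_mx addr0.
rewrite /pf /dpf P1 C1; move: (row_mx (- h) 1%:M) (row_mx (- w) 0) (col_mx 1%:M h) (col_mx 0 w).
move=> P P' C C'; have tt : ((t ^+ 2)%:H)%:M = (t%:H)%:M *m (t%:H)%:M :> 'M[H]_1.
  by rewrite -scalar_mxM -quat_realM expr2.
have TC (X : 'cV[H]_(1 + n)) : (t%:H)%:M *m P' *m M *m X = P' *m M *m X *m (t%:H)%:M.
  by rewrite -!mulmxA real_scalar_mxC !mulmxA.
rewrite tt (mulmxDl P) (mulmxDl (P *m M)) (mulmxDr (P *m M)) (mulmxDr (_ *m P' *m M)).
rewrite (TC C) (TC (C' *m _)) !mulmxA (mulmxDl (P' *m M *m C)).
have gen (x y z u : 'cV[H]_n) : x + y + (z + u) = x + (z + y) + u.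
  by rewrite addrA; congr (_ + _); rewrite -!addrA; congr (_ + _); rewrite addrC.
exact: gen.
Qed.

End ProjectiveFields.

Section QuadraticDerivative.
Variables (R : realType).

Lemma derive_quadratic (V W : normedModType R) (f : V -> W) y w c0 c1 c2 :
  (\forall t \near (0 : R), f (y + t *: w) = c0 + t *: c1 + t ^+ 2 *: c2) ->
  'D_w f y = c1.
Proof.
move=> fE; have fy : f y = c0.
  by have := nbhs_singleton fE; rewrite !scale0r expr0n /= scale0r !addr0.
have lc : (fun t : R => c1 + t *: c2) @ 0^' --> c1.
  rewrite -[X in _ --> X]addr0 -[X in _ --> _ + X](scale0r c2).
  apply: cvg_within_filter; apply: cvgD; first exact: cvg_cst.
  by apply: cvgZr_tmp; exact: cvg_id.
apply: cvg_lim => //; apply: cvg_trans lc; apply: near_eq_cvg.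
apply: filterS2 (nbhs_dnbhs_neq (0 : R)) (nbhs_dnbhs fE) => t t0 e.
rewrite /= [t *: w + y]addrC fy e -(addrA c0) [c0 + _]addrC addrK.
by rewrite scalerDr !scalerA mulVf // scale1r expr2 mulKf.
Qed.

Variable n : nat.
Local Notation H := (quaternion R).
Local Notation E := 'rV[R]_(4 * n).
Local Notation Q := (@quaternionic_col R n).

Lemma derive_projective_field (M : 'M[H]_(1 + n)) (V : E -> E) x r h w :
  (forall h, ball x r (x + h) -> Q (V (x + h)) = projective_field M (Q h)) ->
  ball x r (x + h) -> Q ('D_w V (x + h)) = projective_diff M (Q h) (Q w).
Proof.
move=> VE xh; rewrite -[RHS](@real_rowK R n); congr Q.
apply: (@derive_quadratic _ _ _ _ _ (real_row (projective_field M (Q h))) _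
  (real_row (row_mx (- Q w) 0 *m M *m col_mx 0 (Q w)))).
have r0 : open (ball x r) by exact: ball_open.
have near_ball : \forall t \near (0 : R), ball x r (x + h + t *: w).
  have c : (x + h + t *: w) @[t --> (0 : R)] --> x + h.
    rewrite -[X in _ --> X]addr0 -[X in _ --> _ + X](scale0r w).
    by apply: cvgD; [exact: cvg_cst|apply: cvgZr_tmp; exact: cvg_id].
  exact: c (open_nbhs_nbhs (conj r0 xh)).
apply: filterS near_ball => t; rewrite -addrA => /VE e.
apply: (can_inj (@quaternionic_colK R n)); rewrite e.
have gen (a b c : 'cV[H]_n) (s : R) : Q (real_row a + t *: real_row b + s *: real_row c) =
    a + b *m (quaternion_of_real t)%:M + c *m (quaternion_of_real s)%:M.
  by rewrite !quaternionic_colD !quaternionic_colZ !real_rowK.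
by rewrite gen quaternionic_colD quaternionic_colZ projective_field_line.
Qed.

End QuadraticDerivative.

(** * Tangent vectors to GL(n, H).H^* at the identity *)

Section QuaternionCurves.
Variable R : realType.
Local Notation H := (quaternion R).

(** The derivative at 0 is componentwise because [quaternion] carries no norm here. *)
Definition quat_derive (f : R -> H) (df : H) : Prop :=
  [/\ is_derive (0 : R) 1 (fun t => qre (f t)) (qre df),
      is_derive (0 : R) 1 (fun t => qi (f t)) (qi df),
      is_derive (0 : R) 1 (fun t => qj (f t)) (qj df) &
      is_derive (0 : R) 1 (fun t => qk (f t)) (qk df)].

Lemma quat_derive_unique (f g : R -> H) df dg :
  (\forall t \near (0 : R), f t = g t) -> quat_derive f df -> quat_derive g dg -> df = dg.
Proof.
move=> fg [f1 f2 f3 f4] [g1 g2 g3 g4].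
have key (c : H -> R) : is_derive (0 : R) 1 (fun t => c (f t)) (c df) ->
    is_derive (0 : R) 1 (fun t => c (g t)) (c dg) -> c df = c dg.
  move=> [_ <-] [_ <-]; apply: near_eq_derive.
  by apply: filterS fg => t ->.
by apply: quaternion_eqP; [exact: (key _ f1 g1)|exact: (key _ f2 g2)|
  exact: (key _ f3 g3)|exact: (key _ f4 g4)].
Qed.

(** Each component of a Hamilton product is a sum of four products whose last three signs vary; a
    flag [true] stands for a minus sign. *)
Let dM4 (a b c d a' b' c' d' : R -> R) (s1 s2 s3 : bool)
   (da db dc dd da' db' dc' dd' : R) :
  is_derive (0 : R) 1 a da -> is_derive (0 : R) 1 b db ->
  is_derive (0 : R) 1 c dc -> is_derive (0 : R) 1 d dd ->
  is_derive (0 : R) 1 a' da' -> is_derive (0 : R) 1 b' db' ->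
  is_derive (0 : R) 1 c' dc' -> is_derive (0 : R) 1 d' dd' ->
  let sg (s : bool) (x : R) := if s then - x else x in
  is_derive (0 : R) 1 (fun t => a t * a' t + sg s1 (b t * b' t) + sg s2 (c t * c' t)
     + sg s3 (d t * d' t))
   ((da * a' 0 + a 0 * da') + sg s1 (db * b' 0 + b 0 * db')
    + sg s2 (dc * c' 0 + c 0 * dc') + sg s3 (dd * d' 0 + d 0 * dd')).
Proof.
move=> i1 i2 i3 i4 j1 j2 j3 j4 sg.
have M (f f' : R -> R) df df' : is_derive (0 : R) 1 f df -> is_derive (0 : R) 1 f' df' ->
    is_derive (0 : R) 1 (fun t => f t * f' t) (df * f' 0 + f 0 * df').
  move=> hf hf'; have := is_deriveM hf hf'.
  by rewrite /GRing.scale /= addrC [f' 0 * df]mulrC.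
have S s (f : R -> R) df : is_derive (0 : R) 1 f df ->
    is_derive (0 : R) 1 (fun t => sg s (f t)) (sg s df).
  by move=> hf; case: s => //; exact: is_deriveN.
exact: (is_deriveD (is_deriveD (is_deriveD (M _ _ _ _ i1 j1) (S s1 _ _ (M _ _ _ _ i2 j2)))
  (S s2 _ _ (M _ _ _ _ i3 j3))) (S s3 _ _ (M _ _ _ _ i4 j4))).
Qed.

Lemma quat_deriveM (f g : R -> H) df dg : quat_derive f df -> quat_derive g dg ->
  quat_derive (fun t => f t * g t) (df * g 0 + f 0 * dg).
Proof.
move=> [f1 f2 f3 f4] [g1 g2 g3 g4]; split.
- apply: (is_derive_eq (dM4 true true true f1 f2 f3 f4 g1 g2 g3 g4)).
  by quat_push => /=; ring.
- apply: (is_derive_eq (dM4 false false true f1 f2 f3 f4 g2 g1 g4 g3)).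
  by quat_push => /=; ring.
- apply: (is_derive_eq (dM4 true false false f1 f2 f3 f4 g3 g4 g1 g2)).
  by quat_push => /=; ring.
- apply: (is_derive_eq (dM4 false true false f1 f2 f3 f4 g4 g3 g2 g1)).
  by quat_push => /=; ring.
Qed.

Lemma quat_derive_conj (f : R -> H) df : quat_derive f df ->
  quat_derive (fun t => quat_conj (f t)) (quat_conj df).
Proof. by case=> f1 f2 f3 f4; split; [exact: f1|exact: is_deriveN..]. Qed.

Lemma quat_conjM (x y : H) : quat_conj (x * y) = quat_conj y * quat_conj x.
Proof. by qring. Qed.

Variable n : nat.
Local Notation E := 'rV[R]_(4 * n).
Local Notation Q := (@quaternionic_col R n).
Local Notation Qi := (@real_row R n).
Local Notation "v ** p" := (v *m (p : H)%:M) (at level 40, left associativity).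
Variable i0 : 'I_n.

Lemma quat_derive_col (g : R -> E) dg l : is_derive (0 : R) 1 g dg ->
  quat_derive (fun t => Q (g t) l 0) (Q dg l 0).
Proof.
move=> [gd <-].
have coord i : is_derive (0 : R) 1 (fun t => vec_mx (g t) i l) (vec_mx ('D_1 g 0) i l).
  have [+ _] := derivable_mxP g 0 1 => /(_ gd 0 (mxvec_index i l)) gdc.
  have -> : (fun t => vec_mx (g t) i l) = (fun t => g t 0 (mxvec_index i l)).
    by apply/funext => t; rewrite mxE.
  by split=> //; rewrite derive_mx // !mxE.
have E1 i (c : H -> R) : (forall x : E, c (Q x l 0) = vec_mx x i l) ->
    is_derive (0 : R) 1 (fun t => c (Q (g t) l 0)) (c (Q ('D_1 g 0) l 0)).
  move=> ce; rewrite ce; have -> : (fun t => c (Q (g t) l 0)) = (fun t => vec_mx (g t) i l).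
    by apply/funext => t; rewrite ce.
  exact: coord.
by split; apply: E1 => x; rewrite quaternionic_colE.
Qed.

(* For h = (v |-> A v q) in GL(n, H).H^* one has h(vp) = h(v) z^-1 w with
   z = h(e0)_0 and w = h(e0 p)_0; multiplied by |z|^2 this is polynomial in h. *)
Lemma GLnH_Hstar_relation (h : 'M[R]_(4 * n)) (v : 'cV[H]_n) p l :
  GLnH_Hstar h -> let z := Q (Qi (unit_col R i0) *m h) i0 0 in
  Q (Qi (v ** p) *m h) l 0 * (z * quat_conj z) =
  Q (Qi v *m h) l 0 * quat_conj z * Q (Qi (unit_col R i0 ** p) *m h) i0 0.
Proof.
case=> A [q [_ _ hE]] z.
have hE' (w : 'cV[H]_n) k : Q (Qi w *m h) k 0 = (A *m w) k 0 * q.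
  by rewrite hE mxE real_rowK.
(* Used with x the l-th coordinate of Av and a the [i0]-th coordinate of A e0. Norms are real, hence
   central, and both sides equal |a|^2 |q|^2 xpq. *)
have gen (x a : H) : x * p * q * ((a * q) * quat_conj (a * q)) =
    x * q * quat_conj (a * q) * (a * p * q).
  have -> : x * q * quat_conj (a * q) * (a * p * q) =
      x * (q * quat_conj q) * (quat_conj a * a) * p * q.
    by rewrite quat_conjM !mulrA.
  rewrite !mul_quat_conj mul_conj_quat.
  have comm3 (r s : R) : x * p * q * quaternion_of_real (r * s) =
      x * quaternion_of_real r * quaternion_of_real s * p * q.
    have -> : x * quaternion_of_real r * quaternion_of_real s = x * quaternion_of_real (r * s).
      by rewrite quat_realM mulrA.
    by rewrite -[in RHS]mulrA -[in RHS]mulrA quat_realC !mulrA.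
  have -> : quat_norm2 (a * q) = quat_norm2 q * quat_norm2 a.
    by rewrite /quat_norm2; quat_push; ring.
  exact: comm3.
have comb (x a X Y Z W : H) : X = x * p * q -> Y = x * q -> Z = a * q -> W = a * p * q ->
    X * (Z * quat_conj Z) = Y * quat_conj Z * W.
  by move=> -> -> -> ->; exact: gen.
apply: (comb ((A *m v) l 0) ((A *m unit_col R i0) i0 0)).
- by rewrite hE' mulmxA rscaleE.
- exact: hE'.
- exact: hE'.
- by rewrite hE' mulmxA rscaleE.
Qed.

Lemma quat_relation_derive (f1 f2 z w : R -> H) (x y dz dw a p : H) :
  quat_derive f1 x -> quat_derive f2 y -> quat_derive z dz -> quat_derive w dw ->
  f1 0 = a * p -> f2 0 = a -> z 0 = 1 -> w 0 = p ->
  (\forall t \near (0 : R), f1 t * (z t * quat_conj (z t)) = f2 t * quat_conj (z t) * w t) ->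
  x = y * p + a * (dw - dz * p).
Proof.
move=> d1 d2 hz hw v1 v2 vz vw rel.
have dl := quat_deriveM d1 (quat_deriveM hz (quat_derive_conj hz)).
have dr := quat_deriveM (quat_deriveM d2 (quat_derive_conj hz)) hw.
have := quat_derive_unique rel dl dr; rewrite v1 v2 vz vw => e.
have e1 : x + a * p * (dz + quat_conj dz) = y * p + a * quat_conj dz * p + a * dw.
  move: e; have -> : quat_conj 1 = 1 :> H by qring.
  by rewrite !mulr1 !mul1r mulrDl.
(* The sum of dz and its conjugate is real, so it commutes with p; the conjugate term on the
   right-hand side then cancels. *)
have e2 : a * p * (dz + quat_conj dz) = a * (dz + quat_conj dz) * p by qring.
apply: (@addIr _ (a * p * (dz + quat_conj dz))); rewrite e1 e2.
by qring.
Qed.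

(** Differentiates [GLnH_Hstar_relation] at t = 0 along a curve of group elements starting at the
    identity, where z = 1. *)
Lemma GLnH_Hstar_tangent (g : R -> E -> E) (T : E -> E) :
  (forall v, g 0 v = v) -> (forall v, is_derive (0 : R) 1 (g ^~ v) (T v)) ->
  (\forall t \near (0 : R), exists2 h, @GLnH_Hstar R n h & forall v, g t v = v *m h) ->
  forall v p, Q (T (Qi (v ** p))) = Q (T (Qi v)) ** p +
    v ** (Q (T (Qi (unit_col R i0 ** p))) i0 0 - Q (T (Qi (unit_col R i0))) i0 0 * p).
Proof.
move=> g0 dg gh v p; apply: col_ext => l; rewrite addcolE !rscaleE.
have val0 (u : 'cV[H]_n) k : Q (g 0 (Qi u)) k 0 = u k 0 by rewrite g0 real_rowK.
have d1 := quat_derive_col l (dg (Qi (v ** p))).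
have d2 := quat_derive_col l (dg (Qi v)).
have dz := quat_derive_col i0 (dg (Qi (unit_col R i0))).
have dw := quat_derive_col i0 (dg (Qi (unit_col R i0 ** p))).
have v1 : Q (g 0 (Qi (v ** p))) l 0 = v l 0 * p by rewrite val0 rscaleE.
have vz : Q (g 0 (Qi (unit_col R i0))) i0 0 = 1 by rewrite val0 unit_col1.
have vw : Q (g 0 (Qi (unit_col R i0 ** p))) i0 0 = p by rewrite val0 rscaleE unit_col1 mul1r.
apply: (quat_relation_derive d1 d2 dz dw v1 (val0 v l) vz vw).
by apply: filterS gh => t [h hG gE]; rewrite !gE; exact: GLnH_Hstar_relation.
Qed.

End QuaternionCurves.

(** * Manifolds and group actions *)

(* Otherwise failing unifications unfold derivatives down to limits of filters. *)
Opaque derive diff jacobian.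

(** * Jacobians and partial derivatives *)

Section Jacobians.
Variable R : realType.

Lemma row_space_eq m p (A B : 'M[R]_(m, p)) : (forall v : 'rV[R]_m, v *m A = v *m B) -> A = B.
Proof. by move=> e; apply/row_matrixP => i; rewrite !rowE e. Qed.

Lemma jacobian_near_eq m p (f g : 'rV[R]_m -> 'rV[R]_p) x : (\near x, f x = g x) ->
  differentiable f x -> 'J g x = 'J f x.
Proof.
move=> fg df; have dg := near_eq_differentiable fg df; apply: row_space_eq => v.
exact: (etrans (esym (deriveEjacobian v dg))
  (etrans (esym (near_eq_derive v fg)) (deriveEjacobian v df))).
Qed.

Lemma jacobian_comp m p q (f : 'rV[R]_m -> 'rV[R]_p) (g : 'rV[R]_p -> 'rV[R]_q) x :
  differentiable f x -> differentiable g (f x) -> 'J (g \o f) x = 'J f x *m 'J g (f x).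
Proof.
move=> df dg; apply: row_space_eq => v; have dgf := differentiable_comp df dg.
rewrite mulmxA -(deriveEjacobian v dgf) -(deriveEjacobian v df).
rewrite -(deriveEjacobian _ dg) (deriveE v dgf) (deriveE v df) (deriveE _ dg).
by rewrite diff_comp.
Qed.

Lemma jacobian_near_id m (f : 'rV[R]_m -> 'rV[R]_m) x : (\near x, x = f x) -> 'J f x = 1%:M.
Proof.
have di : differentiable (id : 'rV[R]_m -> 'rV[R]_m) x by exact: ex_diff.
move=> fi; rewrite (jacobian_near_eq fi di).
by apply: row_space_eq => v; rewrite -(deriveEjacobian v di) derive_id mulmx1.
Qed.

Lemma row_mx_affl m p (u : 'rV[R]_m) (y : 'rV[R]_p) :
  row_mx u y = row_mx 0 y + u *m row_mx 1%:M 0.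
Proof. by rewrite mul_mx_row mulmx1 mulmx0 add_row_mx add0r addr0. Qed.

Lemma row_mx_affr m p (u : 'rV[R]_m) (y : 'rV[R]_p) :
  row_mx u y = row_mx u 0 + y *m row_mx 0 1%:M.
Proof. by rewrite mul_mx_row mulmx1 mulmx0 add_row_mx add0r addr0. Qed.

Lemma derive_row_mxl (V : normedModType R) m p (F : 'rV[R]_(m + p) -> V) v u y :
  'D_v (fun u => F (row_mx u y)) u = 'D_(row_mx v 0) F (row_mx u y).
Proof.
have -> : (fun u => F (row_mx u y)) = (fun u => F (row_mx 0 y + u *m row_mx 1%:M 0)).
  by apply/funext => w; rewrite -row_mx_affl.
by rewrite derive_affine -row_mx_affl mul_mx_row mulmx1 mulmx0.
Qed.

Lemma derive_row_mxr (V : normedModType R) m p (F : 'rV[R]_(m + p) -> V) v u y :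
  'D_v (fun y => F (row_mx u y)) y = 'D_(row_mx 0 v) F (row_mx u y).
Proof.
have -> : (fun y => F (row_mx u y)) = (fun y => F (row_mx u 0 + y *m row_mx 0 1%:M)).
  by apply/funext => w; rewrite -row_mx_affr.
by rewrite derive_affine -row_mx_affr mul_mx_row mulmx1 mulmx0.
Qed.

Lemma smooth_on_row_mxl (V : normedModType R) m p (U : set 'rV[R]_(m + p)) (F : 'rV[R]_(m + p) -> V) y :
  smooth_on U F -> smooth_on [set u | U (row_mx u y)] (fun u => F (row_mx u y)).
Proof.
move=> /(smooth_on_affine (row_mx 0 y) (row_mx 1%:M 0)).
have -> : (fun u => F (row_mx 0 y + u *m row_mx 1%:M 0)) = (fun u => F (row_mx u y)).
  by apply/funext => u; rewrite -row_mx_affl.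
suff -> : [set u | U (row_mx 0 y + u *m row_mx 1%:M 0)] = [set u | U (row_mx u y)] by [].
by apply/funext => u /=; rewrite -row_mx_affl.
Qed.

Lemma smooth_on_row_mxr (V : normedModType R) m p (U : set 'rV[R]_(m + p)) (F : 'rV[R]_(m + p) -> V) u :
  smooth_on U F -> smooth_on [set y | U (row_mx u y)] (fun y => F (row_mx u y)).
Proof.
move=> /(smooth_on_affine (row_mx u 0) (row_mx 0 1%:M)).
have -> : (fun y => F (row_mx u 0 + y *m row_mx 0 1%:M)) = (fun y => F (row_mx u y)).
  by apply/funext => y; rewrite -row_mx_affr.
suff -> : [set y | U (row_mx u 0 + y *m row_mx 0 1%:M)] = [set y | U (row_mx u y)] by [].
by apply/funext => y /=; rewrite -row_mx_affr.
Qed.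

End Jacobians.

(** * Local representatives of smooth maps *)

Section LocalMaps.
Variable R : realType.

Lemma local_map_coords m1 m2 (M N : topologicalType) (f : M -> N)
    (c : chart R m1 M) (c' : chart R m2 N) x : dom c x ->
  local_map f c c' (coords c x) = coords c' (f x).
Proof. by move=> cx; rewrite /local_map coordK. Qed.

Lemma near_param m (M : topologicalType) (c : chart R m M) (A : set M) y :
  cod c y -> nbhs (param c y) A -> \forall z \near y, A (param c z).
Proof. by move=> cy; apply: (param_continuous cy). Qed.

Lemma near_cod m (M : topologicalType) (c : chart R m M) y : cod c y -> \forall z \near y, cod c z.
Proof. by move=> cy; apply: open_nbhs_nbhs; split => //; exact: cod_open. Qed.

Lemma near_dom m (M : topologicalType) (c : chart R m M) x : dom c x -> \forall z \near x, dom c z.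
Proof. by move=> cx; apply: open_nbhs_nbhs; split => //; exact: dom_open. Qed.

Lemma local_map_comp m1 m2 m3 (M N P : topologicalType) (f : M -> N) (g : N -> P)
    (c : chart R m1 M) (c' : chart R m2 N) (c'' : chart R m3 P) x :
  {for x, continuous f} -> dom c x -> dom c' (f x) ->
  differentiable (local_map f c c') (coords c x) ->
  differentiable (local_map g c' c'') (coords c' (f x)) ->
  differentiable (local_map (g \o f) c c'') (coords c x) /\
  'J (local_map (g \o f) c c'') (coords c x) =
    'J (local_map f c c') (coords c x) *m 'J (local_map g c' c'') (coords c' (f x)).
Proof.
move=> cf cx cfx df; rewrite -(local_map_coords f c' cx) => dg.
(* The two sides agree only where f stays in the domain of c', which by continuity contains a
   neighbourhood of x. *)
have e : \forall z \near coords c x,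
    (local_map g c' c'' \o local_map f c c') z = local_map (g \o f) c c'' z.
  have := near_param (c := c) (A := f @^-1` dom c') (coord_cod cx).
  rewrite coordK // => /(_ (cf _ (near_dom cfx))).
  by apply: filterS => z; rewrite /local_map /= => /coordK ->.
split; first exact: near_eq_differentiable e (differentiable_comp df dg).
rewrite (jacobian_near_eq e (differentiable_comp df dg)).
exact: jacobian_comp.
Qed.

Lemma local_map_id m (M : topologicalType) (c : chart R m M) x : dom c x ->
  'J (local_map id c c) (coords c x) = 1%:M.
Proof.
move=> cx; apply: jacobian_near_id; apply: filterS (near_cod (coord_cod cx)) => z cz.
by rewrite /local_map paramK.
Qed.

Lemma smooth_map_differentiable m1 m2 (M N : topologicalType)
    (SM : manifold R m1 M) (SN : manifold R m2 N) f c c' x :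
  smooth_map SM SN f -> chart_at SM x c -> chart_at SN (f x) c' ->
  differentiable (local_map f c c') (coords c x).
Proof.
move=> [_ sf] [ac cx] [ac' cfx]; apply: (smooth_on_differentiable (sf _ _ ac ac')).
by split; [exact: coord_cod|rewrite coordK].
Qed.

Lemma transition_differentiable m (M : topologicalType) (S : manifold R m M) c c' x :
  chart_at S x c -> chart_at S x c' -> differentiable (local_map id c c') (coords c x).
Proof.
move=> [ac cx] [ac' cx']; have [+ _] := atlas_compatible ac ac'.
by move=> /smooth_on_differentiable; apply; split; [exact: coord_cod|rewrite coordK].
Qed.

Section TwoVariables.
Variables (m1 m2 m : nat) (M1 M2 N : topologicalType).
Variables (S1 : manifold R m1 M1) (S2 : manifold R m2 M2) (SN : manifold R m N).
Variable f : M1 -> M2 -> N.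
Hypothesis sf : smooth_map2 S1 S2 SN f.

Definition local_map2 (c1 : chart R m1 M1) (c2 : chart R m2 M2) (c : chart R m N) :
    'rV[R]_(m1 + m2) -> 'rV[R]_m :=
  fun z => coords c (f (param c1 (lsubmx z)) (param c2 (rsubmx z))).

Definition local_dom2 (c1 : chart R m1 M1) (c2 : chart R m2 M2) (c : chart R m N) :
    set 'rV[R]_(m1 + m2) :=
  [set z | [/\ cod c1 (lsubmx z), cod c2 (rsubmx z) &
     dom c (f (param c1 (lsubmx z)) (param c2 (rsubmx z)))]].

Lemma smooth_map2_cont1 y : continuous (f ^~ y).
Proof.
move=> x; have [cf _] := sf.
exact: (@continuous_comp _ _ _ (fun x => (x, y)) _ x (cvg_pair cvg_id (cvg_cst y)) (cf (x, y))).
Qed.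

Lemma smooth_map2_cont2 x : continuous (f x).
Proof.
move=> y; have [cf _] := sf.
exact: (@continuous_comp _ _ _ (fun y => (x, y)) _ y (cvg_pair (cvg_cst x) cvg_id) (cf (x, y))).
Qed.

Variables (c1 : chart R m1 M1) (c2 : chart R m2 M2) (c : chart R m N).
Hypotheses (a1 : atlas S1 c1) (a2 : atlas S2 c2) (a : atlas SN c).
Local Notation F := (local_map2 c1 c2 c).
Local Notation D := (local_dom2 c1 c2 c).

Lemma local_map2_smooth : smooth_on D F.
Proof. by have [_ /(_ _ _ _ a1 a2 a)] := sf. Qed.

Lemma local_dom2_open : open D.
Proof.
rewrite openE => z [l r d]; rewrite /interior.
have cl : {for z, continuous (fun z : 'rV[R]_(m1 + m2) => lsubmx z)}.
  exact: differentiable_continuous (differentiable_lsubmx z).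
have cr : {for z, continuous (fun z : 'rV[R]_(m1 + m2) => rsubmx z)}.
  exact: differentiable_continuous (differentiable_rsubmx z).
have [cf _] := sf.
have cF : {for z, continuous (fun z : 'rV[R]_(m1 + m2) => f (param c1 (lsubmx z)) (param c2 (rsubmx z)))}.
  have c1l : {for z, continuous (fun z : 'rV[R]_(m1 + m2) => param c1 (lsubmx z))}.
    exact: (@continuous_comp _ _ _ (fun z : 'rV[R]_(m1 + m2) => lsubmx z) _ z cl (param_continuous l)).
  have c2r : {for z, continuous (fun z : 'rV[R]_(m1 + m2) => param c2 (rsubmx z))}.
    exact: (@continuous_comp _ _ _ (fun z : 'rV[R]_(m1 + m2) => rsubmx z) _ z cr (param_continuous r)).
  exact: (@continuous_comp _ _ _ (fun z => (param c1 (lsubmx z), param c2 (rsubmx z))) _ z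
    (cvg_pair c1l c2r) (cf _)).
have h1 : \forall w \near z, cod c1 (lsubmx w) := cl _ (near_cod l).
have h2 : \forall w \near z, cod c2 (rsubmx w) := cr _ (near_cod r).
have h3 : \forall w \near z, dom c (f (param c1 (lsubmx w)) (param c2 (rsubmx w))) :=
  cF _ (near_dom d).
have sub w : cod c1 (lsubmx w) -> cod c2 (rsubmx w) ->
  dom c (f (param c1 (lsubmx w)) (param c2 (rsubmx w))) -> D w by split.
exact: (filterS3 _ sub h1 h2 h3).
Qed.

Lemma local_dom2_row u y : cod c1 u -> cod c2 y -> dom c (f (param c1 u) (param c2 y)) ->
  D (row_mx u y).
Proof. by move=> cu cy cd; rewrite /local_dom2 /= row_mxKl row_mxKr. Qed.

Lemma local_map2_row u y : F (row_mx u y) = coords c (f (param c1 u) (param c2 y)).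
Proof. by rewrite /local_map2 row_mxKl row_mxKr. Qed.

Lemma local_map2_l y :
  local_map (f ^~ (param c2 y)) c1 c = (fun u => F (row_mx u y)).
Proof. by apply/funext => u; rewrite local_map2_row. Qed.

Lemma local_map2_r u :
  local_map (f (param c1 u)) c2 c = (fun y => F (row_mx u y)).
Proof. by apply/funext => y; rewrite local_map2_row. Qed.

End TwoVariables.

Lemma differentiable_partial1 m1 m2 m (M1 M2 N : topologicalType)
    (S1 : manifold R m1 M1) (S2 : manifold R m2 M2) (SN : manifold R m N) f x y c1 c :
  smooth_map2 S1 S2 SN f -> chart_at S1 x c1 -> chart_at SN (f x y) c ->
  differentiable (local_map (f ^~ y) c1 c) (coords c1 x).
Proof.
move=> sf [a1 d1] [a d]; have [c2 a2 d2] := atlas_cover S2 y.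
have e := local_map2_l f c1 c2 c (coords c2 y); rewrite coordK // in e.
rewrite e; apply: (smooth_on_differentiable (smooth_on_row_mxl (coords c2 y) (local_map2_smooth sf a1 a2 a))).
by apply: local_dom2_row; rewrite ?coordK //; exact: coord_cod.
Qed.

Lemma differentiable_partial2 m1 m2 m (M1 M2 N : topologicalType)
    (S1 : manifold R m1 M1) (S2 : manifold R m2 M2) (SN : manifold R m N) f x y c2 c :
  smooth_map2 S1 S2 SN f -> chart_at S2 y c2 -> chart_at SN (f x y) c ->
  differentiable (local_map (f x) c2 c) (coords c2 y).
Proof.
move=> sf [a2 d2] [a d]; have [c1 a1 d1] := atlas_cover S1 x.
have e := local_map2_r f c1 c2 c (coords c1 x); rewrite coordK // in e.
rewrite e; apply: (smooth_on_differentiable (smooth_on_row_mxr (coords c1 x) (local_map2_smooth sf a1 a2 a))).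
by apply: local_dom2_row; rewrite ?coordK //; exact: coord_cod.
Qed.

End LocalMaps.

Section VectorProductRule.
Variable R : realType.

Lemma is_derive_rV (W : normedModType R) m (f : W -> 'rV[R]_m) x v (df : 'rV[R]_m) :
  (forall j, is_derive x v (fun t => f t 0 j) (df 0 j)) -> is_derive x v f df.
Proof.
move=> h; have fd : derivable f x v.
  by apply/derivable_mxP => i j; rewrite !ord1; have [] := h j.
split=> //; rewrite derive_mx //; apply/rowP => j; rewrite mxE.
by have [_ ->] := h j.
Qed.

(** Serves in [fundamental_field_derive] to differentiate a derivative taken along a direction that
    itself varies. *)
Lemma derive_sum_scale (W : normedModType R) k m (xi : W -> 'rV[R]_k)
    (f : 'I_k -> W -> 'rV[R]_m) x b :
  differentiable xi x -> (forall i, differentiable (f i) x) ->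
  'D_b (fun t => \sum_i xi t 0 i *: f i t) x =
  \sum_i 'D_b xi x 0 i *: f i x + \sum_i xi x 0 i *: 'D_b (f i) x.
Proof.
move=> dxi df; suff [_ ->//] : is_derive x b (fun t => \sum_i xi t 0 i *: f i t)
    (\sum_i 'D_b xi x 0 i *: f i x + \sum_i xi x 0 i *: 'D_b (f i) x).
apply: is_derive_rV => j.
have -> : (fun t => (\sum_i xi t 0 i *: f i t) 0 j) =
    \sum_i ((fun t => xi t 0 i) * (fun t => f i t 0 j)).
  apply/funext => t; rewrite summxE fct_sumE; apply: eq_bigr => i _.
  by rewrite mxE.
have -> : (\sum_i 'D_b xi x 0 i *: f i x + \sum_i xi x 0 i *: 'D_b (f i) x) 0 j =
    \sum_i (xi x 0 i *: 'D_b (f i) x 0 j + f i x 0 j *: 'D_b xi x 0 i).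
  rewrite mxE !summxE -big_split /=; apply: eq_bigr => i _.
  by rewrite !mxE addrC /GRing.scale /= [X in _ + X]mulrC.
apply: is_derive_sum => i; apply: is_deriveM.
  split; last exact: derive_coord.
  exact: (diff_derivable (differentiable_coordf i dxi)).
split; last exact: derive_coord.
exact: (diff_derivable (differentiable_coordf j (df i))).
Qed.

Lemma derive_row_decomposition (V : normedModType R) k m (F : 'rV[R]_(k + m) -> V) (w : 'rV[R]_k) z :
  differentiable F z ->
  'D_(row_mx w 0) F z = \sum_i w 0 i *: 'D_(row i (row_mx 1%:M 0 : 'M[R]_(k, k + m))) F z.
Proof.
move=> dF; have -> : row_mx w 0 = \sum_i w 0 i *: row i (row_mx 1%:M 0 : 'M[R]_(k, k + m)).
  by rewrite -mulmx_sum_row mul_mx_row mulmx1 mulmx0.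
rewrite deriveE // linear_sum; apply: eq_bigr => i _.
by rewrite linearZ deriveE.
Qed.

End VectorProductRule.

(** * Left-invariant vector fields *)

Section LeftInvariant.
Variables (R : realType) (k : nat) (G : topGroupType) (L : lie_group R k G).
Local Notation field := (G -> chart R k G -> 'rV[R]_k).
Local Notation ltr g := (fun h : G => (g * h)%g).

Lemma ltr_continuous (g : G) : continuous (ltr g).
Proof. exact: smooth_map2_cont2 (lie_mul_smooth L) g. Qed.

Lemma ltr_differentiable (g h : G) c c' : chart_at L h c -> chart_at L (g * h)%g c' ->
  differentiable (local_map (ltr g) c c') (coords c h).
Proof. exact: differentiable_partial2 (lie_mul_smooth L). Qed.

Variable c0 : chart R k G.
Hypothesis c0_1 : chart_at L 1%g c0.
Local Notation u0 := (coords c0 1%g).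

(** Extends the tangent vector at 1 with components a in [c0]. The value 0 in charts that do not
    contain g is the convention of [is_tangent]. *)
Definition left_invariant_field (a : 'rV[R]_k) : field := fun g c =>
  if `[< chart_at L g c >] then a *m 'J (local_map (ltr g) c0 c) u0 else 0.

Lemma left_invariant_fieldE a g c : chart_at L g c ->
  left_invariant_field a g c = a *m 'J (local_map (ltr g) c0 c) u0.
Proof. by move=> gc; rewrite /left_invariant_field; case: asboolP. Qed.

Lemma left_invariantE X g c : left_invariant L X -> chart_at L g c ->
  X g c = X 1%g c0 *m 'J (local_map (ltr g) c0 c) u0.
Proof.
by case=> _ _ /(_ g 1%g) h gc; rewrite -(h c0 c) ?mulg1.
Qed.

Lemma left_invariant_field1 a : left_invariant_field a 1%g c0 = a.
Proof.
rewrite left_invariant_fieldE //; have -> : ltr 1%g = id by apply/funext => h; rewrite mul1g.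
by rewrite local_map_id ?mulmx1 //; case: c0_1.
Qed.

Lemma left_invariant_field_leftinv a : left_invariant L (left_invariant_field a).
Proof.
have d1 g c : chart_at L g c -> differentiable (local_map (ltr g) c0 c) u0.
  by move=> gc; apply: ltr_differentiable; rewrite ?mulg1.
have dc0 : dom c0 1%g by case: c0_1.
split.
- move=> g; split=> [c c' gc gc'|c gc]; last by rewrite /left_invariant_field; case: asboolP.
  rewrite (left_invariant_fieldE _ gc) (left_invariant_fieldE _ gc') -mulmxA.
  have dcg : dom c (g * 1)%g by rewrite mulg1; case: gc.
  have dt : differentiable (local_map id c c') (coords c (g * 1)%g).
    by rewrite mulg1; exact: transition_differentiable gc gc'.
  have [_ e] := local_map_comp (@ltr_continuous g 1%g) dc0 dcg (d1 g c gc) dt.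
  by rewrite mulg1 in e; exact: (f_equal (mulmx a) e).
- move=> c ac.
  (* The components of the field at y are the partial derivative along a of the multiplication at
     (y, u0), hence smooth in y. Tangency and invariance are instances of the chain rule. *)
  have sF := smooth_on_derive (row_mx 0 a) (local_map2_smooth (lie_mul_smooth L) ac c0_1.1 ac).
  pose V := [set y | cod c y /\ [set: G] (param c y)].
  have VD y : V y -> local_dom2 (fun g h : G => (g * h)%g) c c0 c (row_mx y u0).
    move=> [cy _]; apply: local_dom2_row => //; first exact: coord_cod.
    by rewrite coordK // mulg1; exact: param_dom.
  have Vo : open V.
    suff -> : V = cod c by exact: cod_open.
    by apply/seteqP; split=> [y []|y cy] //; split.
  apply: (@smooth_on_eq _ _ _ _ (fun y => 'D_(row_mx 0 a)
     (local_map2 (fun g h : G => (g * h)%g) c c0 c) (row_mx y u0))) => //; last first.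
    exact: smooth_onW VD (smooth_on_row_mxl u0 sF).
  move=> y Vy; have cy := Vy.1; have gc : chart_at L (param c y) c by split => //; exact: param_dom.
  rewrite left_invariant_fieldE // -(deriveEjacobian _ (d1 _ _ gc)).
  by rewrite (local_map2_r _ c) derive_row_mxr.
- move=> g h c c' hc ghc.
  rewrite (left_invariant_fieldE _ hc) (left_invariant_fieldE _ ghc) -mulmxA.
  have dch : dom c (h * 1)%g by rewrite mulg1; case: hc.
  have dt : differentiable (local_map (ltr g) c c') (coords c (h * 1)%g).
    by rewrite mulg1; exact: ltr_differentiable hc ghc.
  have [_ e] := local_map_comp (@ltr_continuous h 1%g) dc0 dch (d1 h c hc) dt.
  rewrite mulg1 in e.
  have eL : ltr (g * h)%g = ltr g \o ltr h by apply/funext => w; rewrite /= mulgA.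
  by rewrite eL; exact: (f_equal (mulmx a) e).
Qed.

End LeftInvariant.

(** * Fundamental vector fields of the action *)

Section FundamentalFields.
Variables (R : realType) (k m : nat) (G : topGroupType) (L : lie_group R k G).
Variables (M : topologicalType) (S : manifold R m M) (act : G -> M -> M).
Hypothesis act_smooth : smooth_action L S act.
Variables (c0 : chart R k G) (c : chart R m M).
Hypothesis c0_1 : chart_at L 1%g c0.
Hypothesis ac : atlas S c.
Local Notation u0 := (coords c0 1%g).
Local Notation F := (local_map2 act c0 c c).
Local Notation D := (local_dom2 act c0 c c).
Local Notation ltr g := (fun h : G => (g * h)%g).

Let act1 x : act 1%g x = x. Proof. by have [] := act_smooth. Qed.
Let actM g h x : act (g * h)%g x = act g (act h x). Proof. by have [] := act_smooth. Qed.
Let act2 : smooth_map2 L S S act. Proof. by have [] := act_smooth. Qed.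

Let sF : smooth_on D F. Proof. exact: (local_map2_smooth act2 c0_1.1 ac ac). Qed.
Let Do : open D. Proof. exact: (@local_dom2_open _ _ _ _ _ _ _ _ _ _ _ act2). Qed.

(** Differentiating the action as one map on a product chart makes smoothness in y and linearity in
    a consequences of the smoothness of the action. *)
Definition fundamental_field (a : 'rV[R]_k) (y : 'rV[R]_m) : 'rV[R]_m :=
  'D_(row_mx a 0) F (row_mx u0 y).
Local Notation V := fundamental_field.

Lemma action_dom y : cod c y -> D (row_mx u0 y).
Proof.
move=> cy; apply: local_dom2_row => //; first by apply: coord_cod; case: c0_1.
by rewrite coordK ?act1; [exact: param_dom|case: c0_1].
Qed.

Lemma action_identity y : cod c y -> F (row_mx u0 y) = y.
Proof. by move=> cy; rewrite local_map2_row coordK ?act1 ?paramK //; case: c0_1. Qed.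

Lemma fundamental_field_smooth a : smooth_on (cod c) (V a).
Proof.
have sub : cod c `<=` [set y | D (row_mx u0 y)] := action_dom.
exact: smooth_onW sub (smooth_on_row_mxr u0 (smooth_on_derive (row_mx a 0) sF)).
Qed.

Lemma fundamental_field_lin (r : R) a b y : cod c y ->
  V (r *: a + b) y = r *: V a y + V b y.
Proof.
move=> cy; have dF := smooth_on_differentiable sF (action_dom cy).
rewrite /V; have -> : row_mx (r *: a + b) 0 = r *: row_mx a 0 + row_mx b 0 :> 'rV[R]_(k + m).
  by rewrite scale_row_mx add_row_mx scaler0 addr0.
by rewrite derive_linearD // derive_linearZ.
Qed.

Lemma fundamental_fieldE a x : dom c x ->
  V a (coords c x) = a *m 'J (local_map (act ^~ x) c0 c) u0.
Proof.
move=> cx; have cy := coord_cod cx; have e := local_map2_l act c0 c c (coords c x).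
rewrite coordK // in e; rewrite e -deriveEjacobian ?derive_row_mxl //.
exact: smooth_on_differentiable (smooth_on_row_mxl _ sF) (action_dom cy).
Qed.

(* Differentiates act (g * h) x = act g (act h x) in h at h = 1. *)
Lemma orbit_jacobian g x : dom c x -> chart_at L g c0 -> dom c (act g x) ->
  'J (local_map (ltr g) c0 c0) u0 *m 'J (local_map (act ^~ x) c0 c) (coords c0 g) =
  'J (local_map (act ^~ x) c0 c) u0 *m 'J (local_map (act g) c c) (coords c x).
Proof.
move=> cx gc0 cgx; have dc0 : dom c0 1%g by case: c0_1.
have cx1 : dom c (act 1%g x) by rewrite act1.
have c0g : dom c0 (g * 1)%g by rewrite mulg1; case: gc0.
have d1 : differentiable (local_map (ltr g) c0 c0) u0.
  by apply: (@ltr_differentiable _ _ _ L); rewrite ?mulg1.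
have d2 : differentiable (local_map (act ^~ x) c0 c) (coords c0 (g * 1)%g).
  by rewrite mulg1; exact: (differentiable_partial1 act2).
have d3 : differentiable (local_map (act ^~ x) c0 c) u0.
  by apply: (differentiable_partial1 act2).
have d4 : differentiable (local_map (act g) c c) (coords c (act 1%g x)).
  by rewrite act1; exact: (differentiable_partial2 act2).
have [_] := local_map_comp (@ltr_continuous _ _ _ L g 1%g) dc0 c0g d1 d2.
have [_] := local_map_comp (@smooth_map2_cont1 _ _ _ _ _ _ _ _ _ _ _ act2 x 1%g) dc0 cx1 d3 d4.
rewrite act1 mulg1 => <- <-; congr ('J (local_map _ _ _) _).
by apply/funext => h /=; rewrite actM.
Qed.

(** By left invariance, moving g along X amounts to multiplying g on the right by h moving away from
    1. As act (gh) x = act g (act h x), this has the same effect as moving the point along the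
    fundamental field. *)
Lemma orbit_derivative X u y : left_invariant L X -> cod c0 u -> cod c y ->
  dom c (act (param c0 u) (param c y)) ->
  'D_(row_mx (X (param c0 u) c0) 0) F (row_mx u y) =
  'D_(row_mx 0 (V (X 1%g c0) y)) F (row_mx u y).
Proof.
move=> lX cu cy cuy.
have Duy : D (row_mx u y) by exact: local_dom2_row.
have gc0 : chart_at L (param c0 u) c0 by split; [case: c0_1|exact: param_dom].
have cx := param_dom cy.
rewrite -derive_row_mxl -derive_row_mxr -(local_map2_l act c0 c c y) -(local_map2_r act c0 c c u).
rewrite deriveEjacobian; last first.
  by rewrite -[u](paramK cu); exact: (differentiable_partial1 act2).
rewrite deriveEjacobian; last first.
  by rewrite -[y](paramK cy); exact: (differentiable_partial2 act2).
have e1 := fundamental_fieldE (X 1%g c0) cx; rewrite (paramK cy) in e1.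
have e3 := orbit_jacobian cx gc0 cuy; rewrite (paramK cy) (paramK cu) in e3.
have combine p q r (a A : 'rV[R]_p) (b : 'rV[R]_q) (J1 : 'M[R]_(p, p)) (J2 : 'M[R]_(p, r))
    (J0 : 'M[R]_(p, q)) (J3 : 'M[R]_(q, r)) :
    A = a *m J1 -> b = a *m J0 -> J1 *m J2 = J0 *m J3 -> A *m J2 = b *m J3.
  by move=> -> -> e; rewrite -!mulmxA e.
exact: (combine _ _ _ _ _ _ _ _ _ _ (left_invariantE c0_1 lX gc0) e1 e3).
Qed.

(* Differentiates [orbit_derivative] in u at u0, in the direction b. *)
Lemma fundamental_field_derive X b y : left_invariant L X -> cod c y ->
  V ('D_b (fun u => X (param c0 u) c0) u0) y +
    'D_(row_mx b 0) ('D_(row_mx (X 1%g c0) 0) F) (row_mx u0 y) =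
  'D_(V (X 1%g c0) y) (V b) y.
Proof.
move=> lX cy; set xi := (fun u => _); set a := X 1%g c0; set z := row_mx u0 y.
have Dz : D z := action_dom cy.
have cu0 : cod c0 u0 by apply: coord_cod; case: c0_1.
have xi0 : xi u0 = a by rewrite /xi coordK //; case: c0_1.
pose e i : 'rV[R]_(k + m) := row i (row_mx 1%:M 0 : 'M[R]_(k, k + m)).
have dxi : differentiable xi u0.
  have [_ /(_ c0 c0_1.1) sX _] := lX.
  by apply: (smooth_on_differentiable sX); split.
have dF2 v w : 'D_v ('D_w F) z = 'D_w ('D_v F) z := smooth_on_derive_comm w v Do Dz sF.
have ddF w : differentiable ('D_w F) z := smooth_on_differentiable (smooth_on_derive w sF) Dz.
have dF : differentiable F z := smooth_on_differentiable sF Dz.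
have Du : \forall u \near u0, D (row_mx u y).
  have cr : {for u0, continuous (fun u : 'rV[R]_k => row_mx u y)}.
    have -> : (fun u : 'rV[R]_k => row_mx u y) = (fun u => row_mx 0 y + u *m row_mx 1%:M 0).
      by apply/funext => u; rewrite -row_mx_affl.
    exact: (differentiable_continuous (differentiable_affine _ _ _)).
  exact: (cr _ (open_nbhs_nbhs (conj Do Dz))).
(* The identity [orbit_derivative] near u0, expanded over a basis of the group directions: the
   direction xi(u) varies with u, and the product rule then applies to coefficients and
   derivatives. *)
have star : \forall u \near u0, \sum_i xi u 0 i *: 'D_(e i) F (row_mx u y) =
    'D_(row_mx 0 (V a y)) F (row_mx u y).
  apply: filterS2 Du (near_cod cu0) => u Duy cu.
  rewrite -(derive_row_decomposition (xi u) (smooth_on_differentiable sF Duy)).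
  apply: orbit_derivative => //.
  by have [_ _] := Duy; rewrite row_mxKl row_mxKr.
have dG i : differentiable (fun u => 'D_(e i) F (row_mx u y)) u0.
  exact: (smooth_on_differentiable (smooth_on_row_mxl y (smooth_on_derive (e i) sF)) Dz).
have e1 := etrans (esym (derive_sum_scale b dxi dG)) (etrans (near_eq_derive b star)
  (derive_row_mxl ('D_(row_mx 0 (V a y)) F) b u0 y)).
have e2 : 'D_(V a y) (V b) y = 'D_(row_mx b 0) ('D_(row_mx 0 (V a y)) F) z.
  exact: (etrans (derive_row_mxr ('D_(row_mx b 0) F) (V a y) u0 y) (dF2 _ _)).
have h1 := derive_row_decomposition ('D_b xi u0) dF.
have h3 : \sum_i a 0 i *: 'D_(e i) ('D_(row_mx b 0) F) z =
    \sum_i xi u0 0 i *: 'D_b (fun u => 'D_(e i) F (row_mx u y)) u0.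
  rewrite xi0; apply: eq_bigr => i _.
  exact: (f_equal (fun w => a 0 i *: w) (etrans (dF2 (e i) (row_mx b 0))
    (esym (derive_row_mxl ('D_(e i) F) b u0 y)))).
have h2 := etrans (dF2 (row_mx b 0) (row_mx a 0))
  (etrans (derive_row_decomposition a (ddF (row_mx b 0))) h3).
exact: (etrans (f_equal2 +%R h1 h2) (etrans e1 (esym e2))).
Qed.

(** Two instances of [fundamental_field_derive] are subtracted, and the mixed second derivatives of
    the action cancel. The order on the right is opposite to that of [lie_bracket]: for a left
    action, left-invariant fields map anti-homomorphically to fundamental fields. *)
Lemma fundamental_field_bracket X Y y : left_invariant L X -> left_invariant L Y -> cod c y ->
  V (lie_bracket X Y 1%g c0) y =
  'D_(V (Y 1%g c0) y) (V (X 1%g c0)) y - 'D_(V (X 1%g c0) y) (V (Y 1%g c0)) y.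
Proof.
move=> lX lY cy; have Dz := action_dom cy.
have eX := fundamental_field_derive (Y 1%g c0) lX cy.
have eY := fundamental_field_derive (X 1%g c0) lY cy.
have sw := smooth_on_derive_comm (row_mx (Y 1%g c0) 0) (row_mx (X 1%g c0) 0) Do Dz sF.
have lin a b : V (a - b) y = V a y - V b y.
  have gen (W : lmodType R) (x z : W) : (-1) *: z + x = x - z by rewrite scaleN1r addrC.
  exact: (etrans (f_equal (V ^~ y) (esym (gen _ a b)))
    (etrans (fundamental_field_lin (-1) b a cy) (gen _ _ _))).
have combine (p q r p' q' r' w : 'rV[R]_m) : p + q = r -> p' + q' = r' -> q' = q ->
    w = p' - p -> w = r' - r.
  by move=> <- <- -> ->; rewrite opprD addrACA subrr addr0.
exact: (combine _ _ _ _ _ _ _ eX eY sw (lin _ _)).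
Qed.

End FundamentalFields.

(** * Vanishing fundamental fields and trivial actions *)

Section TrivialAction.
Variables (R : realType) (k m : nat) (G : topGroupType) (L : lie_group R k G).
Variables (M : topologicalType) (S : manifold R m M) (act : G -> M -> M).
Hypothesis act_smooth : smooth_action L S act.
Variable c0 : chart R k G.
Hypothesis c0_1 : chart_at L 1%g c0.
Local Notation u0 := (coords c0 1%g).
Local Notation ltr g := (fun h : G => (g * h)%g).

Let act1 x : act 1%g x = x. Proof. by have [] := act_smooth. Qed.
Let actM g h x : act (g * h)%g x = act g (act h x). Proof. by have [] := act_smooth. Qed.
Let act2 : smooth_map2 L S S act. Proof. by have [] := act_smooth. Qed.

Lemma ltr_jacobian_inv g : chart_at L g c0 ->
  exists J', J' *m 'J (local_map (ltr g) c0 c0) u0 = 1%:M.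
Proof.
move=> gc0; have dc0 : dom c0 1%g by case: c0_1.
exists ('J (local_map (ltr g^-1%g) c0 c0) (coords c0 (g * 1)%g)).
have c0g : chart_at L (g * 1)%g c0 by rewrite mulg1.
have c0e : chart_at L (g^-1 * (g * 1))%g c0 by rewrite mulKg.
have [_ e] := local_map_comp (@ltr_continuous _ _ _ L g 1%g) dc0 c0g.2
  (ltr_differentiable c0_1 c0g) (ltr_differentiable c0g c0e).
have eid : ltr g^-1%g \o ltr g = id by apply/funext => h /=; rewrite mulKg.
rewrite eid in e; exact: (mulmx1C (etrans (esym e) (local_map_id dc0))).
Qed.

(** Vanishing at the point x itself suffices: [orbit_jacobian] carries the zero of the Jacobian of
    the orbit map from 1 to every nearby h, as left translations have invertible Jacobians. *)
Lemma orbit_near_constant x c : chart_at S x c ->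
  (forall a, fundamental_field act c0 c a (coords c x) = 0) ->
  \forall g \near (1%g : G), act g x = x.
Proof.
move=> [ac cx] V0; have cy := coord_cod cx; set y := coords c x in V0 cy.
have dc0 : dom c0 1%g by case: c0_1.
have J0 : 'J (local_map (act ^~ x) c0 c) u0 = 0.
  by apply: row_space_eq => v; rewrite mulmx0 -(fundamental_fieldE act_smooth c0_1 ac).
have Jh h : chart_at L h c0 -> dom c (act h x) ->
    'J (local_map (act ^~ x) c0 c) (coords c0 h) = 0.
  move=> hc0 chx; have := orbit_jacobian act_smooth c0_1 ac cx hc0 chx.
  rewrite J0 mul0mx => e; have [J' J'J] := ltr_jacobian_inv hc0.
  by rewrite -[LHS]mul1mx -J'J -mulmxA e mulmx0.
pose f := local_map (act ^~ x) c0 c.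
pose U := [set u | cod c0 u /\ dom c (act (param c0 u) x)].
have Uu0 : U u0 by split; [exact: coord_cod|rewrite coordK ?act1].
have nU : \forall u \near u0, U u.
  have h1 := near_cod Uu0.1.
  have h2 := near_param (c := c0) (A := [set g | dom c (act g x)]) Uu0.1.
  rewrite coordK // in h2.
  have h3 : nbhs 1%g [set g | dom c (act g x)].
    by apply: (smooth_map2_cont1 act2 (y := x)); rewrite act1; exact: near_dom.
  by apply: filterS2 h1 (h2 h3) => u ? ?; split.
have /nbhs_ballP[r /= r0 rU] := nU.
have chartU u : U u -> chart_at L (param c0 u) c0.
  by move=> [cu _]; split; [case: c0_1|exact: param_dom].
have df u : ball u0 r u -> differentiable f u.
  move=> /rU Uu; have cu := Uu.1; rewrite -[u](paramK cu).
  by apply: (differentiable_partial1 act2 (chartU u Uu)); split => //; exact: Uu.2.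
have d0 u v : ball u0 r u -> 'D_v f u = 0.
  move=> bu; have Uu := rU _ bu; rewrite (deriveEjacobian v (df u bu)).
  have := Jh _ (chartU u Uu) Uu.2; rewrite (paramK Uu.1) -/f => ->.
  exact: mulmx0.
have near1 : \forall g \near (1%g : G), ball u0 r (coords c0 g).
  exact: (Defs.coord_continuous dc0 (nbhsx_ballx _ _ r0)).
apply: filterS2 near1 (near_dom dc0) => g bg cg.
have := derive_zero_ball_rV df d0 bg.
rewrite /f !local_map_coords // act1 => e.
have [_] := rU _ bg; rewrite coordK // => cgx.
by rewrite -(coordK cgx) e coordK.
Qed.

(** Translating the hypothesis by g0 shows that g |-> act g x is locally constant, so the stabilizer
    of x is open and closed. *)
Lemma component_acts_trivially x :
  (forall x, \forall g \near (1%g : G), act g x = x) ->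
  forall g, connected_component [set: G] 1%g g -> act g x = x.
Proof.
move=> loc g Cg; pose C := connected_component [set: G] 1%g.
have locc g0 : \forall g \near g0, act g x = act g0 x.
  have cl := @ltr_continuous _ _ _ L g0^-1%g g0.
  have n1 : nbhs (g0^-1 * g0)%g [set g | act g x = x] by rewrite mulVg; exact: loc.
  have : \forall g \near g0, act (g0^-1 * g)%g x = x := cl _ n1.
  by apply: filterS => h e; rewrite -[h in LHS](mulVKg g0) actM e.
have Po : open [set h | act h x = x].
  rewrite openE => h /= hx; rewrite /interior.
  by apply: filterS (locc h) => h' /= ->.
have Pc : closed [set h | act h x = x].
  rewrite -openC openE => h /= hx; rewrite /interior.
  by apply: filterS (locc h) => h' /= ->.
have CP : C `&` [set h | act h x = x] = C.
  apply: (component_connected (A := [set: G]) (x := 1%g)).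
  - by exists 1%g; split; [exact: connected_component_refl|exact: act1].
  - by exists [set h | act h x = x].
  - by exists [set h | act h x = x].
by move: Cg; rewrite -/(C g) -CP => -[].
Qed.

End TrivialAction.

(** * Automorphisms in integrable charts *)

Section AutomorphismJacobian.
Variables (R : realType) (n : nat) (M : topologicalType) (S : manifold R (4 * n) M).
Variable B : almost_quaternionic S.

(** The coordinate frame belongs to the bundle at x and at f x. The image under f of the frame at x
    has the Jacobian as its matrix in c and also belongs to the bundle, so this matrix relates two
    frames of one orbit. *)
Lemma automorphism_jacobian f c x : quaternionic_automorphism B f -> atlas S c ->
  (forall y, dom c y -> exists2 F, qfibre B y F & F c = 1%:M) ->
  dom c x -> dom c (f x) -> @GLnH_Hstar R n ('J (local_map f c c) (coords c x)).
Proof.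
move=> [sf [f' [sf' fK f'K]] fB] ac Bc cx cfx.
have [F BF Fc] := Bc _ cx; have [F1 BF1 F1c] := Bc _ cfx.
have xc : chart_at S x c by split.
have cf : {for x, continuous f} by have [cf _] := sf; exact: cf.
(* The image of the coordinate frame at x, completed by 0 outside the charts around f x. *)
pose F' c' := if `[< chart_at S (f x) c' >] then 'J (local_map f c c') (coords c x) else 0.
have F'E c' : chart_at S (f x) c' -> F' c' = 'J (local_map f c c') (coords c x).
  by move=> h; rewrite /F'; case: asboolP.
have df c1 c' : chart_at S x c1 -> chart_at S (f x) c' ->
    differentiable (local_map f c1 c') (coords c1 x) := smooth_map_differentiable sf.
have [[Ftan _] _] := qfibre_frame BF.
have F'frame : is_frame S (f x) F'.
  split; first split.
  - move=> c1 c2 h1 h2; rewrite (F'E _ h1) (F'E _ h2).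
    exact: (local_map_comp cf cx h1.2 (df _ _ xc h1) (transition_differentiable h1 h2)).2.
  - by move=> c' h; rewrite /F'; case: asboolP.
  move=> c' h; rewrite (F'E _ h).
  have xc' : chart_at S (f' (f x)) c by rewrite fK.
  have [_ e] := local_map_comp cf cx h.2 (df _ _ xc h) (smooth_map_differentiable sf' h xc').
  have eid : f' \o f = id by apply/funext => z /=; rewrite fK.
  rewrite eid in e; exact: (mulmx1_unit (etrans (esym e) (local_map_id cx))).1.
have dF : differential_maps S S f x F F'.
  move=> c1 c' h1 h'; rewrite (F'E _ h') (Ftan c c1 xc h1) Fc mul1mx.
  exact: (local_map_comp (f := id) (fun A h => h) cx h1.2 (transition_differentiable xc h1) (df _ _ h1 h')).2.
have := (fB x F F' (qfibre_frame BF) F'frame dF).1 BF.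
rewrite (qfibre_orbit BF1) => -[h hG hF].
have e : h *m F1 c = F' c := f_equal (fun F => F c) hF.
by rewrite F1c mulmx1 (F'E c) // in e; rewrite -e.
Qed.

End AutomorphismJacobian.

(** * The representation read off in an integrable chart *)

Section QuaternionicAction.
Variables (R : realType) (k n : nat) (G : topGroupType) (L : lie_group R k G).
Variables (M : topologicalType) (S : manifold R (4 * n) M).
Variables (B : almost_quaternionic S) (act : G -> M -> M).
Local Notation H := (quaternion R).
Local Notation E := 'rV[R]_(4 * n).
Local Notation Q := (@quaternionic_col R n).
Hypothesis act_smooth : smooth_action L S act.
Hypothesis act_automorphism : forall g, quaternionic_automorphism B (act g).
Variables (c0 : chart R k G) (c : chart R (4 * n) M).
Hypothesis c0_1 : chart_at L 1%g c0.
Hypothesis ac : atlas S c.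
Hypothesis Bc : forall y, dom c y -> exists2 F, qfibre B y F & F c = 1%:M.
Local Notation u0 := (coords c0 1%g).
Local Notation F := (local_map2 act c0 c c).
Local Notation D := (local_dom2 act c0 c c).
Local Notation V := (fundamental_field act c0 c).
Variable i0 : 'I_n.

Let act2 : smooth_map2 L S S act. Proof. by have [] := act_smooth. Qed.
Let sF : smooth_on D F. Proof. exact: (local_map2_smooth act2 c0_1.1 ac ac). Qed.
Let Do : open D. Proof. exact: (@local_dom2_open _ _ _ _ _ _ _ _ _ _ _ act2). Qed.

(** The curve consists of the differentials at y of the group elements with coordinates u0 + ta. By
    [automorphism_jacobian] it runs in GL(n, H).H^* for small t, and exchanging derivatives turns
    its velocity into the differential of V a. *)
Lemma fundamental_field_infinitesimal_auto a y : cod c y -> infinitesimal_auto i0 (V a) y.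
Proof.
move=> cy; have Dz := action_dom act_smooth c0_1 cy; set z := row_mx u0 y in Dz.
pose line (t : R) := z + t *: row_mx a 0.
have lineE t : line t = row_mx (u0 + t *: a) y.
  by rewrite /line scale_row_mx add_row_mx scaler0 addr0.
have line0 : line 0 = z by rewrite /line scale0r addr0.
pose g (t : R) (v : E) := 'D_(row_mx 0 v) F (line t).
apply: (@GLnH_Hstar_tangent R n i0 g (fun v => 'D_v (V a) y)).
- move=> v; rewrite /g line0.
  have near_id : \forall w \near y, F (row_mx u0 w) = id w.
    by apply: filterS (near_cod cy) => w cw; exact: (action_identity act_smooth c0_1 cw).
  exact: (etrans (esym (derive_row_mxr F v u0 y)) (etrans (near_eq_derive v near_id) (derive_id _ _))).
- move=> v; have dd : differentiable ('D_(row_mx 0 v) F) (line 0).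
    by rewrite line0; exact: (smooth_on_differentiable (smooth_on_derive _ sF) Dz).
  have := is_derive_line dd; rewrite -/(line 0) line0.
  have -> : 'D_(row_mx a 0) ('D_(row_mx 0 v) F) z = 'D_v (V a) y.
    exact: (etrans (smooth_on_derive_comm (row_mx 0 v) (row_mx a 0) Do Dz sF)
      (esym (derive_row_mxr ('D_(row_mx a 0) F) v u0 y))).
  exact.
have cl : {for (0 : R), continuous line}.
  apply: (@cvgD _ _ _ _ _ (cst z) (fun t : R => t *: row_mx a 0) z); first exact: cvg_cst.
  by apply: cvgZr_tmp; exact: cvg_id.
have nD : \forall t \near (0 : R), D (line t).
  by apply: (cl D); rewrite line0; exact: (open_nbhs_nbhs (conj Do Dz)).
apply: filterS nD => t Dt; set u := u0 + t *: a.
have [cu _ cuy] : D (row_mx u y) by rewrite /u -lineE.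
rewrite row_mxKl in cu; rewrite row_mxKl row_mxKr in cuy.
have cx := param_dom cy.
exists ('J (local_map (act (param c0 u)) c c) (coords c (param c y))).
  exact: (automorphism_jacobian (act_automorphism _) ac Bc cx cuy).
move=> v; have dl : differentiable (local_map (act (param c0 u)) c c) (coords c (param c y)).
  by apply: (differentiable_partial2 act2).
rewrite -(deriveEjacobian v dl) (paramK cy) (local_map2_r _ c0) /g lineE.
exact: (esym (derive_row_mxr F v u y)).
Qed.

Variables (x : M) (r : R).
Hypotheses (cx : dom c x) (r0 : 0 < r) (rc : ball (coords c x) r `<=` cod c).
Local Notation y0 := (coords c x).

(** The origin of the affine chart of HP^n is placed at the coordinates of x, so that a zero matrix
    forces V a to vanish at x itself. *)
Definition represents (a : 'rV[R]_k) (N : 'M[H]_n.+1) : Prop :=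
  in_sl N /\ forall h, ball y0 r (y0 + h) ->
    Q (V a (y0 + h)) = projective_field (N : 'M[H]_(1 + n)) (Q h).

Lemma represents_exists a : exists N, represents a N.
Proof.
have sV := smooth_onW rc (fundamental_field_smooth act_smooth c0_1 ac a).
have [A [q [xi h]]] := infinitesimal_auto_quadratic sV r0
  (fun y by0 => fundamental_field_infinitesimal_auto a (rc by0)).
have [N [N0 NE]] := projective_field_exists A q xi (Q (V a y0)).
by exists N; split=> // w bw; rewrite NE; exact: h.
Qed.

Lemma represents_inj a N N' : represents a N -> represents a N' -> N = N'.
Proof.
move=> [N0 hN] [N'0 hN']; apply: subr0_eq.
apply: (@projective_field_inj R n i0 (N - N' : 'M[H]_(1 + n))); first exact: in_slB.
move=> h; pose w : E := real_row h.
(* Ensures t |w| < r / 2, so that both y0 + tw and y0 - tw lie in the ball. *)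
pose t := r / (1 + `|w|) / 2.
have w0 : 0 < 1 + `|w| by rewrite ltr_pwDl.
have t0 : 0 < t by rewrite !divr_gt0.
exists t; first exact: lt0r_neq0.
have small s : `|s| = t -> ball y0 r (y0 + s *: w).
  move=> st; rewrite -ball_normE /= opprD addNKr normrN normrZ st.
  have : t * (1 + `|w|) = r / 2 by rewrite /t mulrAC divfK // lt0r_neq0.
  by rewrite mulrDr mulr1; move: t0 r0; lra.
have zero s : `|s| = t -> projective_field (N - N' : 'M[H]_(1 + n)) (h *m (quaternion_of_real s)%:M) = 0.
  move=> /small bs; have := hN _ bs; rewrite (hN' _ bs).
  rewrite quaternionic_colZ real_rowK => e.
  by rewrite projective_fieldB e subrr.
by split; apply: zero; rewrite ?normrN gtr0_norm.
Qed.

Lemma represents_lin s a b N N' : represents a N -> represents b N' ->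
  represents (s *: a + b) (quaternion_of_real s *: N + N').
Proof.
move=> [N0 hN] [N'0 hN']; split; first exact: in_sl_lin.
move=> h bh; rewrite (fundamental_field_lin act_smooth c0_1 ac s a b (rc bh)).
rewrite quaternionic_colD quaternionic_colZ (hN _ bh) (hN' _ bh) projective_fieldD.
congr (_ + _); rewrite /projective_field -[quaternion_of_real s *: N]mul_scalar_mx.
rewrite (real_scalar_mxC (N : 'M[H]_(1 + n)) s) -!mulmxA.
by rewrite (real_scalar_mxC (col_mx 1%:M (Q h)) s).
Qed.

Lemma represents_bracket X Y N N' : left_invariant L X -> left_invariant L Y ->
  represents (X 1%g c0) N -> represents (Y 1%g c0) N' ->
  represents (lie_bracket X Y 1%g c0) (N *m N' - N' *m N).
Proof.
move=> lX lY [N0 hN] [N'0 hN']; split; first exact: in_sl_commutator.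
move=> h bh.
have e := fundamental_field_bracket act_smooth c0_1 ac lX lY (rc bh).
have d1 w := derive_projective_field w hN bh.
have d2 w := derive_projective_field w hN' bh.
have colB (u v : E) : Q (u - v) = Q u - Q v by rewrite quaternionic_colD quaternionic_colN.
have combine (p q w w' s : 'cV[H]_n) (z : 'cV[H]_n) :
    p = projective_diff (N : 'M[H]_(1 + n)) z w -> q = projective_diff (N' : 'M[H]_(1 + n)) z w' ->
    w = projective_field (N' : 'M[H]_(1 + n)) z -> w' = projective_field (N : 'M[H]_(1 + n)) z ->
    s = p - q -> s = projective_field (N *m N' - N' *m N : 'M[H]_(1 + n)) z.
  by move=> -> -> -> -> ->; exact: projective_field_bracket.
exact: (combine _ _ _ _ _ _ (d1 _) (d2 _) (hN' _ bh) (hN _ bh) (etrans (f_equal Q e) (colB _ _))).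
Qed.

End QuaternionicAction.

Theorem theorem3p8 (R : realType) (k n : nat)
    (G : topGroupType) (L : lie_group R k G)
    (M : topologicalType) (S : manifold R (4 * n) M)
    (B : almost_quaternionic S) (act : G -> M -> M)
    (M_connected : connected [set: M])
    (B_integrable : quaternionic_integrable B)
    (act_smooth : smooth_action L S act)
    (act_automorphism : forall g, quaternionic_automorphism B (act g))
    (act_nontrivial :
      exists2 g, connected_component [set: G] 1%g g & exists x, act g x <> x) :
  exists rho : (G -> chart R k G -> 'rV[R]_k) -> 'M[quaternion R]_n.+1,
    is_sl_representation L rho /\
    exists2 X, left_invariant L X & rho X <> 0.
Proof.
have [c0 ac0 dc0] := atlas_cover L 1%g.
have c0_1 : chart_at L 1%g c0 by split.
have [x [c [[ac cx] Bc [a Va]]]] : exists x c, [/\ chart_at S x c,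
    (forall y, dom c y -> exists2 F, qfibre B y F & F c = 1%:M) &
    exists a, fundamental_field act c0 c a (coords c x) <> 0].
  apply: contrapT => none; have [g Cg [x gx]] := act_nontrivial; apply: gx.
  apply: (component_acts_trivially act_smooth) Cg => {}x.
  have [c xc Bc] := B_integrable x.
  apply: (orbit_near_constant act_smooth c0_1 xc) => a.
  by apply: contrapT => Va; apply: none; exists x, c; split=> //; exists a.
(* For n = 0 the space R^0 has no nonzero vector, which contradicts [Va]. *)
have [i0 _] : exists i0 : 'I_n, True.
  have [n0|] := posnP n; last by move=> n_gt0; exists (Ordinal n_gt0).
  exfalso; apply: Va; apply/rowP => -[l l_lt]; exfalso.
  by move: l_lt; rewrite n0 muln0.
have cy := coord_cod cx.
have /nbhs_ballP[r /= r0 rc] := near_cod cy.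
have /choice[N NP] : forall b, exists N, represents act c0 c x r b N.
  exact: (represents_exists act_smooth act_automorphism c0_1 ac Bc i0 r0 rc).
have uniq b N1 : represents act c0 c x r b N1 -> N b = N1.
  exact: (represents_inj i0 r0 (NP b)).
exists (fun X => N (X 1%g c0)); split.
  split=> [X lX|s X Y lX lY|X Y lX lY].
  - by have [] := NP (X 1%g c0).
  - apply: uniq; exact: (represents_lin act_smooth c0_1 ac rc s (NP _) (NP _)).
  - apply: uniq; exact: (represents_bracket act_smooth c0_1 ac rc lX lY (NP _) (NP _)).
exists (left_invariant_field L c0 a); first exact: left_invariant_field_leftinv.
rewrite left_invariant_field1 // => N0; apply: Va.
(* At the centre h = 0 of the ball the zero matrix gives V a = 0 at x, against the choice of a. *)
have [_ /(_ 0)] := NP a; rewrite N0 addr0 => /(_ (ballxx _ r0)).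
rewrite /projective_field mulmx0 mul0mx => e.
by rewrite -[LHS](@quaternionic_colK R n) e -(@quaternionic_col0 R n) quaternionic_colK.
Qed.
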